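(* Let $\Omega\subset\mathbb{R}^N$ be a bounded domain with boundary of class $C^2$ and $|\Omega|=1$. Let $p>1$ and $$A:=\left\{v\in L^{p+1}(\Omega)\ :\ \int_\Omega v=0,\ \int_\Omega v^2=1,\ v\ge -1\ \text{on }\Omega\right\}.$$ Then there exist $\theta_0>0$ and $C>0$ such that, for all $\theta\in[0,\theta_0]$, $$\inf_{v\in A}\int_\Omega\left(v|v|^p+\theta|\nabla v|^2\right)\ \ge\ C\sqrt{\theta}.$$
   Context: The inequality $v\ge-1$ is understood almost everywhere. Convention: for $\theta>0$, the integral $\int_\Omega (v|v|^p+\theta|\nabla v|^2)$ is $+\infty$ when $v\notin H^1(\Omega)$; for $\theta=0$ the gradient term is absent. *)

(* Defs.v *)
From HB Require Import structures.
From mathcomp Require Import all_boot all_order all_algebra.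
From mathcomp Require Import all_classical all_reals all_analysis.
From mathcomp Require Import measurable_realfun.

Set Implicit Arguments.
Unset Strict Implicit.
Unset Printing Implicit Defensive.

Import Order.TTheory GRing.Theory Num.Theory.
Import numFieldNormedType.Exports.

Local Open Scope classical_set_scope.
Local Open Scope ring_scope.

(* Borel sigma-algebra, for the norm topology, on 'M[R]_(m, n). *)
Section borel_matrix.
Variables (R : realType) (m n : nat).

Let borel_mx : set (set 'M[R]_(m, n)) := <<s @open 'M[R]_(m, n) >>.

Let borel_mx0 : borel_mx set0. Proof. exact: sigma_algebra0. Qed.

Let borel_mxC A : borel_mx A -> borel_mx (~` A).
Proof. exact: sigma_algebraC. Qed.

Let borel_mx_bigcup (F : (set 'M[R]_(m, n))^nat) :
  (forall i, borel_mx (F i)) -> borel_mx (\bigcup_i F i).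
Proof. exact: sigma_algebra_bigcup. Qed.

HB.instance Definition _ :=
  @isMeasurable.Build (sigma_display (@open 'M[R]_(m, n)))
    'M[R]_(m, n) borel_mx borel_mx0 borel_mxC borel_mx_bigcup.

Lemma open_measurable_mx (A : set 'M[R]_(m, n)) : open A -> measurable A.
Proof. exact: sub_sigma_algebra. Qed.

Lemma continuous_measurable_fun_mx (f : 'M[R]_(m, n) -> R) :
  continuous f -> measurable_fun setT f.
Proof.
move=> /continuousP cf; apply: (measurability _ (RGenOInfty.measurableE R)).
move=> _ [_ [a ->] <-]; rewrite setTI.
by apply: open_measurable_mx; apply: cf; exact: interval_open.
Qed.

End borel_matrix.

Lemma continuous_measurable_fun_mx2 (R : realType) (m n p q : nat)
    (f : 'M[R]_(m, n) -> 'M[R]_(p, q)) :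
  continuous f -> measurable_fun setT f.
Proof.
move=> /continuousP cf; apply: (@measurability _ _ _ _ _ _ (@open 'M[R]_(p, q))).
  by [].
by move=> _ [A oA <-]; rewrite setTI; apply: open_measurable_mx; exact: cf.
Qed.

Section lebesgue_rV.
Variable R : realType.

Definition rV_cons n (z : R * 'rV[R]_n) : 'rV[R]_n.+1 :=
  row_mx (z.1%:M : 'M[R]_1) z.2.

Definition rV_uncons n (x : 'rV[R]_n.+1) : R * 'rV[R]_n :=
  (x ord0 ord0, rsubmx (x : 'rV[R]_(1 + n))).

Lemma rV_cons0 n (z : R * 'rV[R]_n) : rV_cons z ord0 ord0 = z.1.
Proof.
have -> : ord0 = lshift n (ord0 : 'I_1) :> 'I_(1 + n) by exact/val_inj.
apply: etrans (row_mxEl (z.1%:M : 'M[R]_1) z.2 ord0 ord0) _.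
by rewrite mxE eqxx mulr1n.
Qed.

Lemma rV_consS n (z : R * 'rV[R]_n) i : rV_cons z ord0 (rshift 1 i) = z.2 ord0 i.
Proof. exact: (row_mxEr (z.1%:M : 'M[R]_1)). Qed.

Lemma rV_consK n : cancel (@rV_cons n) (@rV_uncons n).
Proof.
by move=> [a y]; rewrite /rV_uncons rV_cons0 /rV_cons row_mxKr.
Qed.

Lemma rV_unconsK n : cancel (@rV_uncons n) (@rV_cons n).
Proof.
move=> x; apply/rowP => j; rewrite /rV_cons /rV_uncons mxE.
case: splitP => k /= jk.
  rewrite (ord1 k) mxE eqxx mulr1n; congr (x _ _); apply/val_inj => /=.
  by rewrite jk (ord1 k).
by rewrite mxE; congr (x _ _); apply/val_inj => /=; rewrite jk.
Qed.

Lemma rV_cons_ball n (c z : R * 'rV[R]_n) (r : R) :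
  ball (rV_cons c) r (rV_cons z) <-> ball c.1 r z.1 /\ ball c.2 r z.2.
Proof.
split=> [[r0 h]|[h1 [r0 h2]]].
- split; first by have := h ord0 ord0; rewrite !rV_cons0.
  by split=> // i j; have := h ord0 (rshift 1 j); rewrite !rV_consS (ord1 i).
- split=> // i j; rewrite (ord1 i); case: (split_ordP (j : 'I_(1 + n))) => k ->.
    rewrite (_ : lshift n k = ord0); last by apply/val_inj; rewrite /= (ord1 k).
    by rewrite !rV_cons0.
  by rewrite !rV_consS; exact: h2.
Qed.

Lemma measurable_rV_cons n : measurable_fun setT (@rV_cons n).
Proof.
apply: (@measurability _ _ _ _ _ _ (@open 'rV[R]_n.+1)) => // _ [A oA <-].
rewrite setTI.
pose c (q : rat * 'rV[rat]_n * rat) : R * 'rV[R]_n :=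
  (ratr q.1.1, map_mx ratr q.1.2).
pose B q := [set z | ball (rV_cons (c q)) (ratr q.2 : R) (rV_cons z) /\
  ball (rV_cons (c q)) (ratr q.2 : R) `<=` A].
have -> : @rV_cons n @^-1` A = \bigcup_q B q.
  apply/seteqP; split=> [z /= Az|z [q _ [qz qA]]]; last exact: qA qz.
  have /nbhs_ballP[e /= e0 eA] : nbhs (rV_cons z) A by exact: open_nbhs_nbhs.
  have [r] := rat_in_itvoo (divr_gt0 e0 (ltr0n R 2)).
  rewrite in_itv/= => /andP[r0 re].
  have rate (x : R) : exists q : rat, ball (ratr q : R) (ratr r) x.
    have [q] : exists q : rat, ratr q \in `]x - ratr r, x + ratr r[.
      by apply: rat_in_itvoo; rewrite ltrBlDr -addrA ltrDl addr_gt0.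
    by rewrite in_itv/= => hq; exists q; rewrite /ball/= ltr_distl.
  have [q1 hq1] := rate z.1.
  have [q2 hq2] : exists q2 : 'I_n -> rat,
      forall i, ball (ratr (q2 i) : R) (ratr r) (z.2 ord0 i).
    have /choice[g hg] := fun i : 'I_n => rate (z.2 ord0 i).
    by exists g.
  exists (q1, \row_i q2 i, r) => //.
  have zB : ball (rV_cons (c (q1, \row_i q2 i, r))) (ratr r : R) (rV_cons z).
    apply/rV_cons_ball; split => //; split => // i j.
    by rewrite /= !mxE (ord1 i).
  split=> // y cy; apply: eA.
  apply: (@le_ball _ _ _ (ratr r + ratr r)).
    by rewrite [leRHS]splitr lerD// ltW.
  by apply: ball_triangle cy; exact: ball_sym.
apply: countable_bigcupT_measurable => // q.
have [qA|qA] := pselect (ball (rV_cons (c q)) (ratr q.2 : R) `<=` A); last first.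
  by rewrite (_ : B q = set0)//; apply/seteqP; split=> // z [].
rewrite (_ : B q = ball (c q).1 (ratr q.2 : R) `*` ball (c q).2 (ratr q.2 : R)).
  have [r0|r0] := ltP 0 (ratr q.2 : R); last first.
    rewrite (_ : ball (c q).1 _ = set0) ?set0X//.
    apply/seteqP; split=> // z; rewrite /ball/= => /(le_lt_trans (normr_ge0 _)).
    by rewrite ltNge r0.
  apply: measurableX.
    by apply: open_measurable; exact: ball_open.
  by apply: open_measurable_mx; exact: ball_open.
by apply/seteqP; split=> z; rewrite /B/= rV_cons_ball => // -[].
Qed.

Lemma measurable_rV_uncons n : measurable_fun setT (@rV_uncons n).
Proof.
apply: measurable_fun_pair => /=.
  by apply: continuous_measurable_fun_mx; exact: coord_continuous.
apply: continuous_measurable_fun_mx2 => x A /nbhs_ballP[e /= e0 eA].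
apply/nbhs_ballP; exists e => //= y [_ xy].
by apply: eA; split=> // i j; rewrite !mxE; exact: xy.
Qed.

Section step.
Variables (n : nat) (mu : {sigma_finite_measure set 'rV[R]_n -> \bar R}).

Definition lebesgue_rVS : set 'rV[R]_n.+1 -> \bar R :=
  pushforward (lebesgue_measure \x mu)%E (@rV_cons n).

Let lebesgue_rVS0 : lebesgue_rVS set0 = 0%E.
Proof. by rewrite /lebesgue_rVS /pushforward preimage_set0 measure0. Qed.

Let lebesgue_rVS_ge0 A : (0 <= lebesgue_rVS A)%E.
Proof. exact: (measure_ge0 (lebesgue_measure \x mu)%E). Qed.

Let lebesgue_rVS_sigma_additive : semi_sigma_additive lebesgue_rVS.
Proof.
move=> F mF tF mUF; rewrite /lebesgue_rVS /pushforward preimage_bigcup.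
have mpre A : measurable A -> measurable (@rV_cons n @^-1` A).
  by move=> mA; rewrite -[X in measurable X]setTI; exact: measurable_rV_cons.
apply: measure_semi_sigma_additive; first by move=> k; exact: mpre.
- apply/trivIsetP => i j _ _ ij; rewrite -preimage_setI.
  by move/trivIsetP : tF => /(_ _ _ _ _ ij) ->//; rewrite preimage_set0.
- by rewrite -preimage_bigcup; exact: mpre.
Qed.

HB.instance Definition _ := isMeasure.Build _ _ _ lebesgue_rVS
  lebesgue_rVS0 lebesgue_rVS_ge0 lebesgue_rVS_sigma_additive.

Let lebesgue_rVS_sigma_finite : sigma_finite setT lebesgue_rVS.
Proof.
have /sigma_finiteP[F [TF ndF Foo]] := sigma_finiteT (@lebesgue_measure R).
have /sigma_finiteP[G [TG ndG Goo]] := sigma_finiteT mu.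
exists (fun k => @rV_uncons n @^-1` (F k `*` G k)).
  apply/esym; rewrite -subTset => x _.
  have [i _ Fi] : (\bigcup_i F i) (rV_uncons x).1 by rewrite -TF.
  have [j _ Gj] : (\bigcup_i G i) (rV_uncons x).2 by rewrite -TG.
  exists (maxn i j) => //; split.
    by move: Fi; exact/subsetPset/ndF/leq_maxl.
  by move: Gj; exact/subsetPset/ndG/leq_maxr.
move=> k; have [mF Fk] := Foo k; have [mG Gk] := Goo k.
have mFG : measurable (F k `*` G k) by exact: measurableX.
split.
  by rewrite -[X in measurable X]setTI; exact: measurable_rV_uncons.
rewrite /lebesgue_rVS /pushforward.
rewrite (_ : @rV_cons n @^-1` _ = F k `*` G k).
  by rewrite product_measure1E// lte_mul_pinfty// ge0_fin_numE.
by rewrite -comp_preimage (_ : _ \o _ = id)//; apply/funext; exact: rV_consK.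
Qed.

HB.instance Definition _ := Measure_isSigmaFinite.Build _ _ _ lebesgue_rVS
  lebesgue_rVS_sigma_finite.

End step.

(* Lebesgue measure on R^n: the image of the n-fold product of the
   one-dimensional Lebesgue measure, by R^n.+1 = R * R^n. *)
Fixpoint lebesgue_rV (n : nat) : {sigma_finite_measure set 'rV[R]_n -> \bar R} :=
  match n with
  | 0 => \d_(0 : 'rV[R]_0)
  | k.+1 => lebesgue_rVS (lebesgue_rV k)
  end.

End lebesgue_rV.
Arguments lebesgue_rV {R n}.

Section function_spaces.
Variables (R : realType) (n : nat).
Implicit Types (Omega : set 'rV[R]_n) (v phi : 'rV[R]_n -> R).

Local Notation leb := (@lebesgue_rV R n).

Definition partial (i : 'I_n) (f : 'rV[R]_n -> R) : 'rV[R]_n -> R :=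
  fun x => 'D_(delta_mx ord0 i) f x.

(* f is of class C^k on R^n *)
Fixpoint classC (k : nat) (f : 'rV[R]_n -> R) : Prop :=
  continuous f /\
  match k with
  | 0 => True
  | l.+1 => forall i, (forall x, derivable f x (delta_mx ord0 i)) /\
                      classC l (partial i f)
  end.

Definition test_function Omega phi :=
  [/\ forall k, classC k phi,
      compact (closure [set x | phi x != 0]) &
      closure [set x | phi x != 0] `<=` Omega].

(* v in L^q(Omega); only the values of v on Omega matter. *)
Definition in_Lp Omega (q : R) v := v \_ Omega \in Lfun leb q%:E.

Definition is_L2_weak_gradient Omega v (G : 'rV[R]_n -> 'rV[R]_n) :=
  forall i : 'I_n, in_Lp Omega 2 (fun x => G x ord0 i) /\
    forall phi, test_function Omega phi ->
      (\int[leb]_(x in Omega) (v x * partial i phi x)%:E =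
       - \int[leb]_(x in Omega) (G x ord0 i * phi x)%:E)%E.

Definition sobolev_H1 Omega v :=
  in_Lp Omega 2 v /\ exists G, is_L2_weak_gradient Omega v G.

(* Any weak gradient of v; two of them agree almost everywhere on Omega. *)
Definition weak_gradient Omega v : 'rV[R]_n -> 'rV[R]_n :=
  xget (fun=> 0) [set G | is_L2_weak_gradient Omega v G].

(* The norm `|x| of the library on 'rV[R]_n is the sup norm. *)
Definition sqr_euclid (x : 'rV[R]_n) : R := \sum_(i < n) x ord0 i ^+ 2.

Definition energy Omega (p theta : R) v : \bar R :=
  if theta == 0 then (\int[leb]_(x in Omega) (v x * `|v x| `^ p)%:E)%E
  else if pselect (sobolev_H1 Omega v) then
    (\int[leb]_(x in Omega) (v x * `|v x| `^ p +
       theta * sqr_euclid (weak_gradient Omega v x))%:E)%E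
  else +oo%E.

Definition admissible Omega (p : R) : set ('rV[R]_n -> R) :=
  [set v | [/\ in_Lp Omega (p + 1) v,
    (\int[leb]_(x in Omega) (v x)%:E = 0)%E,
    (\int[leb]_(x in Omega) (v x ^+ 2)%:E = 1)%E &
    {ae leb, forall x, Omega x -> -1 <= v x}]].

End function_spaces.

(* Near each boundary point, and up to relabelling (i) and reflecting (b) a
   coordinate axis, Omega is the set of points lying above the graph of a
   function of class C^2 of the other coordinates. *)
Definition C2_boundary (R : realType) (n : nat) (Omega : set 'rV[R]_n) :=
  forall x0, (closure Omega `\` Omega°) x0 ->
    exists (r : R) (i : 'I_n) (b : bool) (gamma : 'rV[R]_n.-1 -> R),
      [/\ 0 < r, classC 2 gamma &
        forall x, ball x0 r x ->
          (Omega x <-> gamma (col' i x) < (-1) ^+ b * x ord0 i)].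

(* Main.v *)
Require Import Defs.
From mathcomp Require Import all_boot all_order all_algebra.
From mathcomp Require Import all_classical all_reals all_analysis.
From mathcomp Require Import measurable_realfun ring lra.
Set Implicit Arguments.
Unset Strict Implicit.
Unset Printing Implicit Defensive.
Import Order.TTheory GRing.Theory Num.Theory.
Import numFieldNormedType.Exports.
Local Open Scope classical_set_scope.
Local Open Scope ring_scope.

(** Set [W v = (v - 1)^2 / 2] for [v > 0] and [W v = |1 - v^2| / 2] for
    [v <= 0]. For [v >= -1] one has
    [v |v|^p >= v + (p / 2) (v^2 - 1) + W v], and the first two terms on the
    right integrate to [0] under the constraints, so the energy [E] dominates
    [\int W v + theta \int |grad v|^2]. Since [\int v = 0], a small [\int W v]
    forces [{v > 0}] to occupy between 1/8 and 7/8 of Omega.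

    For [0 < t <= sqrt theta], a point where [v] changes sign between [x] and
    [x + t e_i] has [W] bounded below at [x] or at [x + t e_i], or a jump of
    size at least 1/2, so the measure of such points is at most
    [16 \int W v + 4 t^2 \int |d_i v|^2 <= 16 E]. Chaining such steps,
    translations of bounded length move the indicator of [{v > 0}] by
    [O(E / sqrt theta)] in L^1 of every cube whose double lies in Omega;
    integrating over all translations (Fubini) bounds
    [|Q /\ {v > 0}| |Q \ {v > 0}|] by [O(E / sqrt theta)]. Hence if
    [E / sqrt theta] is small, then [v] is mostly in one phase on each such
    cube, and, Omega being connected and exhausted up to a small
    measure by finitely many cubes, in the same phase on most of Omega:
    a contradiction. *)

(** * Lebesgue measure on row vectors *)

(** Two obstacles shape the argument: [v] is known only through integrals against test functions,
    and the constant must not depend on [v]. Because of the first, the Modica-Mortola route (total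
    variation of a function of [v], relative isoperimetric inequality) is replaced by finite
    differences [v (x + t e_i) - v x], which the definition of a weak gradient controls once it is
    tested against products of one-variable bumps. The scale [sqrt theta] balances two needs:
    [t^2 <= theta] lets the energy pay for the gradient term of one step, and a distance of order 1
    then takes about [1 / sqrt theta] steps, each costing a multiple of [E]. Because of the second,
    the propagation through Omega is stated for a family of sets, later indexed by all pairs
    [(theta, v)]: the threshold on [E / sqrt theta] is fixed before any pair is chosen. *)

Section measure_preserving.
Context d (T : measurableType d) (R : realType) (mu : {measure set T -> \bar R}).
Variable phi : T -> T.
Hypotheses (mphi : measurable_fun setT phi)
  (phi_mu : forall A, measurable A -> mu (phi @^-1` A) = mu A).

Lemma ge0_integral_preserving (f : T -> \bar R) :
  measurable_fun setT f -> (forall x, 0 <= f x)%E ->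
  (\int[mu]_x f (phi x) = \int[mu]_x f x)%E.
Proof.
move=> mf f0; have := ge0_integral_pushforward mphi mu measurableT mf.
rewrite preimage_setT => <-; last by move=> y _; exact: f0.
by apply: eq_measure_integral => A mA _; exact: phi_mu.
Qed.

Lemma integrable_preserving (f : T -> \bar R) :
  mu.-integrable setT f -> mu.-integrable setT (f \o phi).
Proof.
move=> /integrableP[mf f_lty]; apply/integrableP; split.
  exact: measurableT_comp mf mphi.
rewrite (ge0_integral_preserving (f := abse \o f))//; first exact: measurableT_comp.
by move=> x; exact: abse_ge0.
Qed.

Lemma integral_preserving (f : T -> \bar R) :
  mu.-integrable setT f -> (\int[mu]_x f (phi x) = \int[mu]_x f x)%E.
Proof.
move=> fi; have mf := measurable_int _ fi.
have := @integral_pushforward _ _ _ _ _ phi mphi mu setT f mf.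
rewrite preimage_setT => /(_ (integrable_preserving fi) measurableT) <-.
by apply: eq_measure_integral => A mA _; exact: phi_mu.
Qed.

End measure_preserving.

Section lebesgue_rV_theory.
Variable R : realType.

(** By induction on the dimension: [f] is [rV_cons] applied to its first coordinate and its tail,
    and [rV_cons] is measurable. In dimension 0 the codomain is a single point. *)
Lemma measurable_fun_rV d (T : measurableType d) n (f : T -> 'rV[R]_n) :
  (forall j, measurable_fun setT (fun t => f t ord0 j)) -> measurable_fun setT f.
Proof.
elim: n f => [f _|n IH f mf].
  move=> _ A mA; rewrite setTI.
  have [A0|A0] := pselect (A 0); last first.
    rewrite (_ : f @^-1` A = set0)//; apply/seteqP; split=> // x /=.
    by rewrite thinmx0.
  rewrite (_ : f @^-1` A = setT)//; apply/seteqP; split=> // x _ /=.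
  by rewrite thinmx0.
rewrite (_ : f = @rV_cons R n \o (@rV_uncons R n \o f)); last first.
  by apply/funext => t /=; rewrite rV_unconsK.
apply: measurableT_comp; first exact: measurable_rV_cons.
apply: measurable_fun_pair => /=; first exact: mf.
apply: IH => j; rewrite (_ : (fun _ => _) = fun t => f t ord0 (rshift 1 j)).
  exact: mf.
by apply/funext => t; rewrite mxE.
Qed.

Lemma measurable_coord n (j : 'I_n) :
  measurable_fun setT (fun x : 'rV[R]_n => x ord0 j).
Proof. by apply: continuous_measurable_fun_mx; exact: coord_continuous. Qed.

Lemma measurable_funD_rV d (T : measurableType d) n (f g : T -> 'rV[R]_n) :
  measurable_fun setT f -> measurable_fun setT g ->
  measurable_fun setT (fun t => f t + g t).
Proof.
move=> mf mg; apply: measurable_fun_rV => j.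
under eq_fun do rewrite mxE; apply: measurable_funD.
- exact: measurableT_comp (measurable_coord _) mf.
- exact: measurableT_comp (measurable_coord _) mg.
Qed.

Lemma measurable_shift n (h : 'rV[R]_n) :
  measurable_fun setT (fun x : 'rV[R]_n => x + h).
Proof. by apply: measurable_funD_rV => //; exact: measurable_cst. Qed.

(** Uniqueness of Lebesgue measure: its image under the translation agrees with it on half-open
    intervals. *)
Lemma lebesgue_measure_shift (h : R) A : measurable A ->
  lebesgue_measure ((fun x : R => x + h) @^-1` A) = lebesgue_measure A.
Proof.
move=> mA.
have mh : measurable_fun setT (fun x : R => x + h) by exact: measurable_funD.
apply/esym.
apply: (@lebesgue_measure_unique R (pushforward lebesgue_measure
   ((fun x : R => x + h) : measurableTypeR R -> measurableTypeR R))) => // X.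
move=> [[a b]] _ <-; rewrite /=.
rewrite [RHS](_ : _ = lebesgue_measure `]a - h, b - h]%classic).
  rewrite !lebesgue_measure_itv/= !lte_fin ltrD2r.
  by case: ifPn => // _; rewrite -!EFinD; congr EFin; ring.
congr (lebesgue_measure _); apply/seteqP; split=> x /=; rewrite !in_itv/=.
  by move=> /andP[? ?]; apply/andP; split; lra.
by move=> /andP[? ?]; apply/andP; split; lra.
Qed.

(** Slice by slice, by induction on [n]: the first coordinate of [h] translates the outer variable
    of the iterated integral, and its tail translates each section, where the induction hypothesis
    applies. *)
Lemma lebesgue_rV_shift n (h : 'rV[R]_n) A : measurable A ->
  lebesgue_rV ((fun x : 'rV[R]_n => x + h) @^-1` A) = lebesgue_rV A.
Proof.
elim: n h A => [h A _|n IH h A mA].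
  rewrite (_ : (fun x => x + h) = id)// funeqE => x.
  by rewrite [LHS]thinmx0 [x]thinmx0.
have mC B : measurable B -> measurable (@rV_cons R n @^-1` B).
  by move=> mB; rewrite -[X in measurable X]setTI; exact: measurable_rV_cons.
rewrite /= /lebesgue_rVS /pushforward /=.
have mhA : measurable ((fun x => x + h) @^-1` A).
  by rewrite -[X in measurable X]setTI; exact: measurable_shift.
rewrite /product_measure1.
pose F (a : R) := (lebesgue_rV \o xsection (@rV_cons R n @^-1` A)) a.
transitivity (\int[lebesgue_measure]_a F (a + (rV_uncons h).1)%R)%E; last first.
  rewrite (ge0_integral_preserving (mu := lebesgue_measure)
    (phi := fun a : measurableTypeR R => a + (rV_uncons h).1))//.
  - exact: measurable_funD.
  - exact: lebesgue_measure_shift.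
  - by apply: measurable_fun_xsection; exact: mC.
apply: eq_integral => a _; rewrite /F /=.
rewrite -[RHS](IH (rV_uncons h).2); last first.
  by apply: measurable_xsection; exact: mC.
have E y : rV_cons (a, y) + h =
    rV_cons (a + (rV_uncons h).1, y + (rV_uncons h).2).
  apply/rowP => j; rewrite mxE; case: (split_ordP (j : 'I_(1 + n))) => k ->.
    rewrite (_ : lshift n k = ord0); last by apply/val_inj; rewrite /= (ord1 k).
    by rewrite !rV_cons0.
  by rewrite !rV_consS/= !mxE.
congr (lebesgue_rV _); rewrite /xsection /preimage.
by apply/seteqP; split=> y; rewrite /= !inE /= E.
Qed.

(** Balls of the sup norm are cubes, hence products of an interval and a cube of one dimension
    less. *)
Lemma lebesgue_rV_ball_gt0 n (c : 'rV[R]_n) (r : R) : 0 < r ->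
  (0 < lebesgue_rV (ball c r))%E.
Proof.
elim: n c => [c r0|n IH c r0].
  by rewrite /= diracE mem_set ?lte01//; split=> // i [].
rewrite /= /lebesgue_rVS /pushforward/=.
rewrite (_ : _ @^-1` _ = ball (rV_uncons c).1 r `*` ball (rV_uncons c).2 r).
  rewrite product_measure1E.
  - rewrite mule_gt0//; last exact: IH.
    rewrite [ltRHS](_ : _ = (r *+ 2)%:E) ?lte_fin ?mulrn_wgt0//.
    exact/lebesgue_measure_ball/ltW.
  - by apply: open_measurable; exact: ball_open.
  - by apply: open_measurable_mx; exact: ball_open.
apply/seteqP; split=> z.
  by rewrite /preimage/= -{1}(rV_unconsK c) => /rV_cons_ball.
by rewrite /preimage/= -{3}(rV_unconsK c) => ?; exact/rV_cons_ball.
Qed.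

Definition box n (a b : 'I_n -> R) : set 'rV[R]_n :=
  [set x | forall j, a j < x ord0 j < b j].

Lemma measurable_box n (a b : 'I_n -> R) : measurable (box a b).
Proof.
rewrite (_ : box a b = \bigcap_(j in [set: 'I_n])
    ((fun x : 'rV[R]_n => x ord0 j) @^-1` `]a j, b j[)).
  apply: fin_bigcap_measurable => // j _.
  by rewrite -[X in measurable X]setTI; exact: measurable_coord.
apply/seteqP; split=> [x xab j _|x xab j]; first by rewrite /= in_itv/=.
by have := xab j I; rewrite /= in_itv/=.
Qed.

Lemma setI_box n (a b a' b' : 'I_n -> R) : box a b `&` box a' b' =
  box (fun j => Num.max (a j) (a' j)) (fun j => Num.min (b j) (b' j)).
Proof.
apply/seteqP; split=> [x [h h'] j|x h].
  by have := h j; have := h' j; rewrite gt_max lt_min => /andP[-> ->] /andP[-> ->].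
by split=> j; have := h j; rewrite gt_max lt_min => /andP[/andP[? ?] /andP[? ?]];
  apply/andP.
Qed.

Definition boxes n := [set box ab.1 ab.2 | ab in [set: ('I_n -> R) * ('I_n -> R)]].

(** The nontrivial inclusion says that the identity is measurable from the sigma-algebra of boxes.
    This is checked on coordinates, each half-space [x_j > a] being a countable union of boxes. *)
Lemma measurable_boxesE n :
  @measurable _ 'rV[R]_n = <<s @boxes n >>.
Proof.
apply/seteqP; split=> [A mA|A]; last first.
  apply: smallest_sub => //; first exact: sigma_algebra_measurable.
  by move=> _ [[a b] _ <-]; exact: measurable_box.
suff : measurable_fun setT (idfun : g_sigma_algebraType (@boxes n) -> 'rV[R]_n).
  by move=> /(_ measurableT _ mA); rewrite setTI.
apply: measurable_fun_rV => j.
apply: (measurability _ (RGenOInfty.measurableE R)).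
move=> _ [_ [a ->] <-]; rewrite setTI.
pose B k := box (fun i => if i == j then a else - k%:R) (fun=> k%:R).
rewrite (_ : _ @^-1` _ = \bigcup_k B k).
  apply: bigcupT_measurable => k; apply: sub_sigma_algebra.
  by exists (fun i => if i == j then a else - k%:R, fun=> k%:R).
apply/seteqP; split=> [x /=|x [k _ /(_ j)]]; last first.
  by rewrite /= eqxx in_itv/= andbT => /andP[].
rewrite in_itv/= andbT => ax; exists (Num.truncn `|x : 'rV[R]_n|).+1 => // i.
have : `|(x : 'rV[R]_n) ord0 i| < (Num.truncn `|x : 'rV[R]_n|).+1%:R.
  have : ball (0 : 'rV[R]_n) (Num.truncn `|x : 'rV[R]_n|).+1%:R x.
    by rewrite mx_norm_ball /ball_/= sub0r normrN truncnS_gt.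
  by move=> [_ /(_ ord0 i)]; rewrite mxE /ball/= sub0r normrN.
rewrite ltr_norml => /andP[h1 h2]; rewrite h2 andbT; by case: ifPn => // /eqP ->.
Qed.

(** Dynkin's argument: boxes are stable under intersection and generate the Borel sets, so the
    integral of [f] vanishes on every measurable part of [D]. *)
Lemma ae_eq0_boxes n (D : set 'rV[R]_n) (f : 'rV[R]_n -> \bar R) :
  measurable D -> lebesgue_rV.-integrable D f ->
  (\int[lebesgue_rV]_(x in D) f x = 0)%E ->
  (forall a b, \int[lebesgue_rV]_(x in D `&` box a b) f x = 0)%E ->
  ae_eq lebesgue_rV D f (cst 0%E).
Proof.
move=> mD fi fD fbox.
have f0 A : measurable A -> (\int[lebesgue_rV]_(x in D `&` A) f x = 0)%E.
  rewrite measurable_boxesE; move: A.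
  apply: (@dynkin_induction _ _ (@boxes n)
    (fun A => \int[lebesgue_rV]_(x in D `&` A) f x = 0)%E (measurable_boxesE n)).
  - move=> _ _ [[a b] _ <-] [[a' b'] _ <-]; rewrite setI_box.
    by eexists (_, _).
  - by rewrite setIT.
  - by move=> _ [[a b] _ <-]; exact: fbox.
  - move=> S mS S0; have := fD.
    rewrite -{1}(setIT D) -(setUv S) setIUr integral_setU//; first last.
    + by apply/disj_setPS => x [[_ ?] [_]].
    + rewrite -setIUr; apply: measurable_funS (measurable_int _ fi) => //.
    + by apply: measurableI => //; exact: measurableC.
    + exact: measurableI.
    by rewrite S0 add0e.
  - move=> F mF tF F0; rewrite setI_bigcupr integral_bigcup//.
    + by apply: eseries0 => i _ _; exact: F0.
    + by apply: trivIset_setIl.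
    + by move=> i; exact: measurableI.
    + apply: integrableS fi => //; last by move=> x [i _ []].
      by apply: bigcup_measurable => k _; exact: measurableI.
apply: integral_ae_eq => // E ED mE.
by rewrite integral_cst// mul0e -(f0 E mE) (setIidr ED).
Qed.

End lebesgue_rV_theory.

(** * Smooth test functions *)

Section smooth1.
Variable R : realType.
Implicit Types f g : R -> R.

Fixpoint diffn (n : nat) f : Prop :=
  if n is m.+1 then
    exists f', (forall x : R, is_derive x 1 f (f' x)) /\ diffn m f'
  else True.

Definition smooth f := forall n, diffn n f.

Lemma diffn_le n f : diffn n.+1 f -> diffn n f.
Proof.
elim: n f => // n IH f [f' [df f'n]]; exists f'; split => //.
by apply: IH.
Qed.

Lemma diffn_cst n (k : R) : diffn n (cst k).
Proof.
elim: n k => // n IH k; exists (cst 0).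
by split=> [x|]; [exact: is_derive_cst|exact: IH].
Qed.

Lemma diffnD n f g : diffn n f -> diffn n g -> diffn n (fun x => f x + g x).
Proof.
elim: n f g => //= n IH f g [f' [df f'n]] [g' [dg g'n]].
by exists (fun x => f' x + g' x); split => [x|]; [exact: is_deriveD|exact: IH].
Qed.

Lemma diffnM n f g : diffn n f -> diffn n g -> diffn n (fun x => f x * g x).
Proof.
elim: n f g => // n IH f g fn gn.
have [[f' [df f'n]] [g' [dg g'n]]] := (fn, gn).
exists (fun x => f x * g' x + g x * f' x); split => [x|].
  exact: is_deriveM.
by apply: diffnD; apply: IH => //; exact: diffn_le.
Qed.

Lemma diffn_affine n f (k b : R) : diffn n f -> diffn n (fun x => f (k * x + b)).
Proof.
elim: n f => // n IH f [f' [df f'n]].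
exists (fun x => f' (k * x + b) * k); split => [x|]; last first.
  by apply: diffnM; [exact: IH|exact: diffn_cst].
have dg : is_derive x 1 (fun y => k * y + b) k.
  have := is_deriveD (is_deriveZ k (is_derive_id x 1)) (is_derive_cst b x 1).
  by rewrite addr0 /GRing.scale/= mulr1.
exact: (@is_derive1_comp _ f (fun y => k * y + b)).
Qed.

Lemma smooth_continuous f : smooth f -> continuous f.
Proof.
move=> /(_ 1%N)[f' [df _]] x.
by apply: differentiable_continuous; apply/derivable1_diffP; case: (df x).
Qed.

Lemma smooth_measurable f : smooth f -> measurable_fun setT f.
Proof.
by move=> sf; apply: continuous_measurable_fun; exact: smooth_continuous.
Qed.

Lemma smoothM f g : smooth f -> smooth g -> smooth (fun x => f x * g x).
Proof. by move=> sf sg n; apply: diffnM. Qed.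

Lemma smooth_affine f (k b : R) : smooth f -> smooth (fun x => f (k * x + b)).
Proof. by move=> sf n; apply: diffn_affine. Qed.

(* The polynomial parameter makes this family closed under differentiation. *)
Definition flat (P : {poly R}) (x : R) : R :=
  if 0 < x then P.[x^-1] * expR (- x^-1) else 0.

(** Exponentials beat powers: [y^m / m! <= e^y]. The exponent [m] stays general because each factor
    ['X] met in the induction on [P] is absorbed as one more power of [y]. *)
Lemma poly_le_expR (P : {poly R}) m : exists2 C, 0 <= C &
  forall y, 0 <= y -> `|P.[y]| * y ^+ m <= C * expR y.
Proof.
elim/poly_ind: P m => [|P c IH] m.
  by exists 0 => // y _; rewrite horner0 normr0 !mul0r.
have [C C0 CP] := IH m.+1; exists (C + `|c| * m`!%:R).
  by rewrite addr_ge0// mulr_ge0.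
move=> y y0; rewrite hornerMXaddC.
apply: (@le_trans _ _ (`|P.[y]| * y ^+ m.+1 + `|c| * y ^+ m)).
  rewrite exprS mulrA -mulrDl ler_wpM2r ?exprn_ge0//.
  by rewrite (le_trans (ler_normD _ _))// normrM (ger0_norm y0).
rewrite mulrDl lerD//; first exact: CP.
rewrite -mulrA ler_wpM2l//.
case: m {IH CP} => [|m]; first by rewrite mul1r; have := expR_ge1Dx y; lra.
rewrite mulrC -ler_pdivrMr ?ltr0n ?fact_gt0//.
by have := expR_ge1Dxn m y0; lra.
Qed.

(** The growth bound with [m = 2] at [y = 1 / h]. Order 2 at the origin is what gives [flat P] a
    zero derivative there. *)
Lemma flat_sqr_bound P : exists2 C, 0 <= C & forall h, `|flat P h| <= C * h ^+ 2.
Proof.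
have [C C0 CP] := poly_le_expR P 2; exists C => // h; rewrite /flat.
case: ifPn => [h0|_]; last by rewrite normr0 mulr_ge0// sqr_ge0.
have hV0 : 0 <= h^-1 by rewrite invr_ge0 ltW.
have := CP _ hV0.
rewrite normrM (ger0_norm (expR_ge0 _)) expRN ler_pdivrMr ?expR_gt0//.
by rewrite exprVn ler_pdivrMr ?exprn_gt0// mulrAC.
Qed.

(** For [x > 0] the derivative of [P(1/x) e^(-1/x)] is [x^-2 (P - P')(1/x) e^(-1/x)], whence the
    polynomial [X^2 (P - P')]. *)
Lemma is_derive_flat P (x : R) :
  is_derive x 1 (flat P) (flat ('X^2 * (P - P^`())) x).
Proof.
have [x0|x0|<-] := ltgtP 0 x.
- rewrite {2}/flat x0.
  apply: (@near_eq_is_derive R R^o R^o (fun x : R => P.[x^-1] * expR (- x^-1))).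
    near=> y; rewrite /flat ifT//; near: y; exact: lt_nbhsr.
  have dV : is_derive x 1 (fun y : R => y^-1) (- x^-2).
    have := @is_deriveV _ idfun x 1 1 (lt0r_neq0 x0) (is_derive_id _ _).
    by rewrite /= /GRing.scale/= mulr1.
  have dP : is_derive x 1 (fun y : R => P.[y^-1]) (P^`().[x^-1] * - x^-2).
    exact: (@is_derive1_comp _ (horner P) (fun y => y^-1)).
  have dN : is_derive x 1 (fun y : R => - y^-1) (x^-2).
    by have := is_deriveN dV; rewrite opprK.
  have dE : is_derive x 1 (fun y : R => expR (- y^-1)) (expR (- x^-1) * x^-2).
    exact: (@is_derive1_comp _ expR (fun y => - y^-1)).
  apply: (is_derive_eq (is_deriveM dP dE)).
  rewrite /GRing.scale/= hornerM hornerXn hornerD hornerN -exprVn.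
  by ring.
- rewrite {2}/flat ltNge (ltW x0)/=.
  apply: (@near_eq_is_derive R R^o R^o (cst 0)) => //.
  near=> y; rewrite /flat ifF//; apply/negbTE; rewrite -leNgt; apply: ltW.
  by near: y; exact: lt_nbhsl.
- rewrite {2}/flat ltxx; have [C C0 CP] := flat_sqr_bound P.
  suff q0 : h^-1 *: (flat P (h *: 1 + 0) - flat P 0) @[h --> 0^'] --> (0 : R).
    by apply: DeriveDef; [apply/cvg_ex; exists 0|exact/cvg_lim].
  apply/cvgrPdist_lt => e e0; near=> h.
  have h0 : h != 0 by near: h; exact: nbhs_dnbhs_neq.
  rewrite sub0r normrN {2}/flat ltxx subr0 addr0 /GRing.scale/= mulr1.
  rewrite normrM normfV mulrC ltr_pdivrMr ?normr_gt0//.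
  apply: (le_lt_trans (CP h)); rewrite -real_normK ?num_real// expr2 mulrA.
  rewrite ltr_pM2r ?normr_gt0//.
  have hlt : `|h| < e / (C + 1).
    by near: h; apply: dnbhs0_lt; rewrite divr_gt0// ltr_wpDl.
  move: hlt; rewrite ltr_pdivlMr ?ltr_wpDl// => hlt.
  by apply: le_lt_trans hlt; rewrite mulrC ler_wpM2l// lerDl.
Unshelve. all: by end_near. Qed.

Lemma smooth_flat P : smooth (flat P).
Proof.
move=> n; elim: n P => //= n IH P; exists (flat ('X^2 * (P - P^`()))).
by split => // x; exact: is_derive_flat.
Qed.

(** The factor [k.+1] stretches the argument of [flat 1], so that the values tend to 1 inside []a,
    b[] as [k] grows while the function keeps vanishing outside. *)
Definition cutoff (a b : R) (k : nat) (x : R) : R :=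
  flat 1 (k.+1%:R * x + - (k.+1%:R * a)) * flat 1 (- k.+1%:R * x + k.+1%:R * b).

Lemma smooth_cutoff a b k : smooth (cutoff a b k).
Proof. by apply: smoothM; apply: smooth_affine; exact: smooth_flat. Qed.

Lemma cutoffE a b k x : cutoff a b k x =
  if a < x < b then
    expR (- (k.+1%:R * (x - a))^-1) * expR (- (k.+1%:R * (b - x))^-1) else 0.
Proof.
rewrite /cutoff (_ : _ + - _ = k.+1%:R * (x - a)); last by ring.
rewrite (_ : _ + k.+1%:R * b = k.+1%:R * (b - x)); last by ring.
rewrite /flat !pmulr_rgt0 ?ltr0n// !subr_gt0 !hornerE.
by case: (a < x); case: (x < b); rewrite /= ?mul1r ?mul0r ?mulr0.
Qed.

Lemma cutoff_ge0 a b k x : 0 <= cutoff a b k x.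
Proof. by rewrite cutoffE; case: ifP => // _; rewrite mulr_ge0// expR_ge0. Qed.

Lemma cutoff_le1 a b k x : cutoff a b k x <= 1.
Proof.
rewrite cutoffE; case: ifP => // /andP[ax xb].
by rewrite mulr_ile1 ?expR_ge0// expR_le1 oppr_le0 invr_ge0 mulr_ge0// subr_ge0 ltW.
Qed.

Lemma cutoff_eq0 a b k x : ~~ (a < x < b) -> cutoff a b k x = 0.
Proof. by rewrite cutoffE => /negbTE ->. Qed.

Lemma cvg_cutoff a b x :
  cutoff a b k x @[k --> \oo] --> (((a < x < b)%R : nat)%:R : R).
Proof.
have [/[dup] axb /andP[ax xb]|axb] := boolP (a < x < b); last first.
  by under eq_fun do rewrite cutoff_eq0//; exact: cvg_cst.
under eq_fun do rewrite cutoffE axb.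
have E (y : R) : 0 < y -> expR (- (k.+1%:R * y)^-1) @[k --> \oo] --> (1 : R).
  move=> y0.
  suff : expR (- (k.+1%:R * y)^-1) @[k --> \oo] --> expR (- 0 : R).
    by rewrite oppr0 expR0.
  apply: continuous_cvg; first exact: continuous_expR.
  apply: cvgN; under eq_fun do rewrite invfM.
  by rewrite -(mul0r y^-1); apply: cvgM; [exact: cvg_harmonic|exact: cvg_cst].
have xa : 0 < x - a by rewrite subr_gt0.
have bx : 0 < b - x by rewrite subr_gt0.
by have := cvgM (E _ xa) (E _ bx); rewrite mulr1; apply.
Qed.

End smooth1.

(** * Sliding integrals of one-variable bumps *)

Section window.
Context {R : realType}.
Implicit Types (f : R -> R) (a b t x : R).
Local Notation leb := (@lebesgue_measure R).

Definition primitive f x : R := (\int[leb]_(y in `]-oo, x]) f y)%R.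

(** For [t >= 0] this is the integral of an integrable [f] over []x - t, x]]. Written with
    primitives, it has derivative [f x - f (x - t)] by the fundamental theorem of calculus. *)
Definition window f t x := primitive f x - primitive f (x - t).

Section supported.
Variables (f : R -> R) (a b : R).
Hypotheses (sf : smooth f) (f0 : forall x, ~~ (a < x < b) -> f x = 0).

Lemma integrable_supported : leb.-integrable setT (EFin \o f).
Proof.
rewrite (_ : f = f \_ `[a, b]).
  rewrite -restrict_EFin -integrable_mkcond//.
  apply: continuous_compact_integrable; first exact: segment_compact.
  by apply: continuous_subspaceT; exact: smooth_continuous.
apply/funext => x; rewrite patchE; case: ifPn => // /negP xab; rewrite f0//.
apply/negP => /andP[ax xb]; apply: xab; rewrite inE/= in_itv/=.
by rewrite !ltW.
Qed.

Lemma is_derive_primitive x : is_derive x 1 (primitive f) (f x).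
Proof.
have [||||df <-] := @continuous_FTC1 R f -oo%O x (x + 1).
- by rewrite ltrDl.
- exact: integrableS integrable_supported.
- by rewrite ltNyr.
- by move=> ?; exact: smooth_continuous.
by apply: DeriveDef; [exact: df|rewrite derive1E].
Qed.

Lemma is_derive_window t x : is_derive x 1 (window f t) (f x - f (x - t)).
Proof.
have dt : is_derive x 1 (fun y : R => y - t) 1.
  by have := is_deriveB (is_derive_id x 1) (is_derive_cst t x 1); rewrite subr0.
apply: is_deriveB (is_derive_primitive x) _.
rewrite -[f (x - t)]mulr1.
apply: (@is_derive1_comp _ (primitive f) (fun y => y - t) x _ _ _ dt).
exact: is_derive_primitive.
Qed.

Lemma smooth_window t : smooth (window f t).
Proof.
case=> // n; exists (fun x => f x - f (x - t)); split.
  exact: is_derive_window.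
have -> : (fun x => f x - f (x - t)) =
    (fun x => f x + (fun=> -1) x * f (1 * x + - t)).
  by apply/funext => x; rewrite mulN1r mul1r.
apply: diffnD; first exact: sf.
by apply: diffnM; [exact: diffn_cst|exact: diffn_affine].
Qed.

Lemma windowE t x : 0 <= t ->
  ((window f t x)%:E = \int[leb]_(u in `](- t)%R, 0%R]) (f (x + u)%R)%:E)%E.
Proof.
move=> t0; have fi := integrable_supported.
have fiS (A : set R) : measurable A -> leb.-integrable A (EFin \o f).
  by move=> mA; exact: integrableS fi.
rewrite /window /primitive /Rintegral EFinB !fineK; first last.
- by apply: integrable_fin_num => //; exact: fiS.
- by apply: integrable_fin_num => //; exact: fiS.
rewrite (_ : `]-oo, x]%classic = `]-oo, x - t] `|` `]x - t, x]); last first.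
  by rewrite -itv_bndbnd_setU// bnd_simp lerBlDr lerDl.
rewrite integral_setU//=; first last.
- apply/disj_setPS => y [] /=; rewrite !in_itv/= => yx /andP[xy _].
  by move: (lt_le_trans xy yx); rewrite ltxx.
- by apply/measurable_EFinP; apply: measurable_funTS; exact: smooth_measurable.
rewrite addeAC subee; last by apply: integrable_fin_num => //; exact: fiS.
rewrite add0e integral_mkcond [RHS]integral_mkcond.
have mf : measurable_fun setT f by exact: smooth_measurable.
rewrite -(@integral_preserving _ _ _ lebesgue_measure (fun u => u + x)).
- apply: eq_integral => u _; rewrite /patch !mem_setE !in_itv/=.
  rewrite gerDr (addrC x u) (_ : (x - t < u + x) = (- t < u))//.
  by apply/idP/idP; lra.
- exact: measurable_funD.
- by move=> A; exact: lebesgue_measure_shift.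
- by rewrite -integrable_mkcond//; exact: fiS.
Qed.

Lemma window_eq0 t x : 0 <= t -> ~~ (a < x < b + t) -> window f t x = 0.
Proof.
move=> t0 xab; apply: EFin_inj; rewrite windowE//.
apply: integral0_eq => u; rewrite /= in_itv/= => /andP[tu u0].
congr EFin; apply: f0; apply: contra xab => /andP[? ?]; apply/andP; split; lra.
Qed.

End supported.
End window.

(** * Test functions in product form *)

Section prodf.
Variables (R : realType) (n : nat).
Implicit Types (h : 'I_n -> R -> R) (i : 'I_n) (x : 'rV[R]_n).

Definition prodf h (x : 'rV[R]_n) : R := \prod_j h j (x ord0 j).

Lemma prodfD1 h i x : prodf h x =
  h i (x ord0 i) * \prod_(j | j != i) h j (x ord0 j).
Proof. by rewrite /prodf (bigD1 i). Qed.

Definition updf h i (g : R -> R) j := if j == i then g else h j.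

(** Along the i-th axis the other factors are frozen, so the difference quotient is a constant
    multiple of the one of [h i]. *)
Lemma is_derive_prodf h i x (g : R -> R) :
  is_derive (x ord0 i) 1 (h i) (g (x ord0 i)) ->
  is_derive x (delta_mx ord0 i) (prodf h) (prodf (updf h i g) x).
Proof.
set C := \prod_(j | j != i) h j (x ord0 j) => dh.
have -> : prodf (updf h i g) x = g (x ord0 i) * C.
  rewrite (prodfD1 _ i) /updf eqxx; congr (_ * _).
  by apply: eq_bigr => j /negbTE ->.
have -> : g (x ord0 i) * C = C *: g (x ord0 i) by rewrite mulrC.
have [dC vC] := is_deriveZ C dh.
have E : (fun s : R => s^-1 *: (prodf h (s *: delta_mx ord0 i + x) - prodf h x)) =
    fun s => s^-1 *: ((C \*: h i) (s *: 1 + x ord0 i) - (C \*: h i) (x ord0 i)).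
  apply/funext => s; congr (_ *: _); rewrite /= !(prodfD1 _ i) !mxE !eqxx.
  rewrite mulr1 /GRing.scale/= mulr1 -/C !(mulrC C); congr (_ * _ - _).
  by apply: eq_bigr => j /negbTE ji; rewrite !mxE eqxx ji mulr0 add0r.
split; first by rewrite /derivable /= E; exact: dC.
by rewrite /derive /= E; exact: vC.
Qed.

Lemma continuous_prodf h : (forall j, continuous (h j)) -> continuous (prodf h).
Proof.
move=> ch; rewrite /prodf; elim: (index_enum _) => [|j s IH].
  rewrite (_ : (fun _ => _) = cst 1); first by move=> x; exact: cst_continuous.
  by apply/funext => y; rewrite big_nil.
rewrite (_ : (fun _ => _) = (h j \o (fun y : 'rV[R]_n => y ord0 j)) \*
    (fun y => \prod_(k <- s) h k (y ord0 k))).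
  move=> x; apply: continuousM; last exact: IH.
  by apply: continuous_comp; [exact: coord_continuous|exact: ch].
by apply/funext => y; rewrite big_cons.
Qed.

(** Each partial derivative is again a product of smooth functions, with only the i-th factor
    changed, which closes the induction on [k]. *)
Lemma classC_prodf k h : (forall j, smooth (h j)) -> classC k (prodf h).
Proof.
elim: k h => [|k IH] h sh.
  by split => //; apply: continuous_prodf => j; exact: smooth_continuous.
split; first by apply: continuous_prodf => j; exact: smooth_continuous.
move=> i.
have /choice[D hD] : forall m, exists f', (forall x : R, is_derive x 1 (h i) (f' x))
  /\ diffn m f' by move=> m; have := sh i m.+1.
(* [smooth] yields one derivative witness per order; uniqueness of derivatives identifies them, so a
   single function is differentiable to every order. *)
have DE m : D m = D 0%N.
  apply/funext => x; have [d1 _] := hD m; have [d2 _] := hD 0%N.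
  by have [_ <-] := d1 x; have [_ <-] := d2 x.
have d x : is_derive x (delta_mx ord0 i) (prodf h) (prodf (updf h i (D 0%N)) x).
  by apply: is_derive_prodf; have [] := hD 0%N.
split=> [x|]; first by have [] := d x.
rewrite (_ : partial i (prodf h) = prodf (updf h i (D 0%N))).
  apply: IH => j; rewrite /updf; case: ifPn => // _ m.
  by rewrite -(DE m); have [] := hD m.
by apply/funext => x; have [] := d x.
Qed.

Lemma measurable_prodf h : (forall j, smooth (h j)) ->
  measurable_fun setT (prodf h).
Proof.
move=> sh; apply: continuous_measurable_fun_mx; apply: continuous_prodf => j.
exact: smooth_continuous.
Qed.

Lemma test_function_prodf (Omega : set 'rV[R]_n) h (a b : 'I_n -> R) :
  (forall j, smooth (h j)) ->
  (forall j (x : R), ~~ (a j < x < b j) -> h j x = 0) ->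
  [set x : 'rV[R]_n | forall j, a j <= x ord0 j <= b j] `<=` Omega ->
  test_function Omega (prodf h).
Proof.
move=> sh h0 abO.
pose K := [set x : 'rV[R]_n | forall j, `[a j, b j]%classic (x ord0 j)].
have cK : compact K.
  apply: (@rV_compact _ _ (fun j => `[a j, b j]%classic)) => j.
  exact: segment_compact.
have sK : closure [set x | prodf h x != 0] `<=` K.
  apply: (@subset_trans _ (closure K)).
    apply: closureS => x /= /prodf_neq0 hx j.
    rewrite /= in_itv/=; have := hx j isT; apply: contraNT => xab.
    by rewrite h0//; apply: contra xab => /andP[? ?]; rewrite !ltW.
  move/compact_closed : cK => /(_ (@norm_hausdorff _ _)) /closure_id <-.
  exact: subset_refl.
split.
- by move=> k; exact: classC_prodf.
- by apply: subclosed_compact cK sK; exact: closed_closure.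
- apply: subset_trans sK _ => x Kx; apply: abO => j.
  by have := Kx j; rewrite /= in_itv.
Qed.

End prodf.

(** * Difference quotients of functions with a weak gradient *)

Section slide.
Variables (R : realType) (n : nat) (f : 'rV[R]_n -> R) (e : 'rV[R]_n) (t : R).
Hypotheses (fi : lebesgue_rV.-integrable setT (EFin \o f)) (t0 : 0 <= t).
Local Notation leb := (@lebesgue_rV R n).
Local Notation leb1 := (@lebesgue_measure R).

Let ind : R -> R := \1_`]- t, 0%R].

Lemma integral_ind : (\int[leb1]_u (ind u)%:E = t%:E)%E.
Proof.
rewrite integral_indic// setIT.
have := lebesgue_measure_itv `]- t, 0]; rewrite /= => ->.
rewrite lte_fin oppr_lt0; case: ltP => [_|tle0]; first by rewrite add0e opprK.
by congr EFin; apply/le_anti; rewrite t0 tle0.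
Qed.

Lemma ind_ge0 u : 0 <= ind u. Proof. by rewrite /ind indicE. Qed.

Lemma measurable_ind : measurable_fun setT ind.
Proof. exact: measurable_indic. Qed.

Lemma integrable_ind : leb1.-integrable setT (EFin \o ind).
Proof. exact: integrable_indic_itv. Qed.

Definition kern z u := f (z - u *: e) * ind u.

Let mf : measurable_fun setT f.
Proof. by apply/measurable_EFinP; exact: measurable_int fi. Qed.

Lemma measurable_shift_line (s : R) :
  measurable_fun setT
    (fun zu : 'rV[R]_n * measurableTypeR R => zu.1 + (s * zu.2) *: e).
Proof.
apply: measurable_funD_rV => //.
apply: measurable_fun_rV => j; under eq_fun do rewrite mxE.
by apply: measurable_funM => //; exact: measurable_funM.
Qed.

Lemma measurable_kern :
  measurable_fun setT (fun zu : 'rV[R]_n * measurableTypeR R => kern zu.1 zu.2).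
Proof.
apply: measurable_funM; last exact: (measurableT_comp measurable_ind).
have := measurableT_comp mf (measurable_shift_line (-1)).
by congr measurable_fun; apply/funext => z /=; rewrite mulN1r scaleNr.
Qed.

Lemma shift_line_preserving (u : R) A : measurable A ->
  leb ((fun z : 'rV[R]_n => z - u *: e) @^-1` A) = leb A.
Proof. exact: lebesgue_rV_shift. Qed.

(** Tonelli with [z] integrated first: by translation invariance each [u] contributes the L^1 norm
    of [f], and the relevant [u] fill an interval of length [t]. *)
Lemma integrable_kern : (leb \x leb1)%E.-integrable setT
  (fun zu : 'rV[R]_n * measurableTypeR R => (kern zu.1 zu.2)%:E).
Proof.
apply/integrable21ltyP; first by apply/measurable_EFinP; exact: measurable_kern.
have [_ flty] := integrableP _ _ _ fi.
have mfa : measurable_fun setT (fun x => `|(f x)%:E|)%E.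
  by apply: measurableT_comp => //; apply/measurable_EFinP; exact: mf.
have E u : (\int[leb]_z `|(kern z u)%:E| = (ind u)%:E * \int[leb]_x `|(f x)%:E|)%E.
  rewrite -ge0_integralZl ?lee_fin ?ind_ge0//.
  pose g x := ((ind u)%:E * `|(f x)%:E|)%E.
  transitivity (\int[leb]_z g (z - u *: e)%R)%E.
    apply: eq_integral => z _.
    by rewrite /g/kern/= normrM EFinM muleC (ger0_norm (ind_ge0 u)).
  apply: (@ge0_integral_preserving _ _ _ leb (fun z : 'rV[R]_n => z - u *: e)).
  - exact: measurable_shift.
  - exact: shift_line_preserving.
  - exact: measurable_funeM.
  - by move=> x; rewrite mule_ge0// lee_fin ind_ge0.
under eq_integral => u _ do rewrite E.
rewrite ge0_integralZr//; last 3 first.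
- by apply/measurable_EFinP; exact: measurable_ind.
- by move=> u _; rewrite lee_fin ind_ge0.
- exact: integral_ge0.
by rewrite integral_ind lte_mul_pinfty.
Qed.

(* This is [\int_0^t f (z + s e) ds], with [u = - s] so that only translation
   invariance is needed. *)
Definition slide z : R := (\int[leb1]_u kern z u)%R.

Let F z := (\int[leb1]_u (kern z u)%:E)%E.

(** [slide] takes a default value where the inner integral is not finite; Fubini makes the set of
    such points negligible. *)
Lemma slide_fine : {ae leb, forall z, (slide z)%:E = F z}.
Proof.
have := ae_integrable1 integrable_kern; apply: filterS => z /= zi.
by rewrite /slide/Rintegral fineK//; apply: integrable_fin_num.
Qed.

Lemma integrable_slide : leb.-integrable setT (EFin \o slide).
Proof.
apply: (le_integrable measurableT _ _ (integrable_fubini_F integrable_kern)).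
  apply/measurable_EFinP; apply: measurableT_comp => //.
  exact: (measurable_fubini_F integrable_kern).
move=> z _; rewrite /= /slide /Rintegral /fubini_F.
by case: (\int[_]_u _)%E => [r||] //=; rewrite ?leey// normr0.
Qed.

(** Sliding moves from [f] to the test function: exchange the integrals, substitute [x = z - u e]
    for each fixed [u], and exchange back. *)
Lemma integral_slideM (phi : 'rV[R]_n -> R) :
  measurable_fun setT phi -> (forall x, `|phi x| <= 1) ->
  (\int[leb]_z (slide z * phi z)%:E =
   \int[leb]_x ((f x)%:E * \int[leb1]_u (phi (x + u *: e)%R * ind u)%:E))%E.
Proof.
move=> mphi phi1.
have phib : [bounded phi x | x in setT].
  exists 1; split; rewrite ?num_real// => M M1 x _.
  exact: le_trans (phi1 x) (ltW M1).
pose H2 (zu : 'rV[R]_n * measurableTypeR R) := (kern zu.1 zu.2 * phi zu.1)%:E.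
have mH2 : measurable_fun setT H2.
  apply/measurable_EFinP; apply: measurable_funM; first exact: measurable_kern.
  exact: measurableT_comp mphi _.
have iH2 : (leb \x leb1)%E.-integrable setT H2.
  apply: (le_integrable measurableT mH2 _ integrable_kern) => zu _.
  by rewrite /H2 lee_fin normrM ler_piMr.
pose H (xu : 'rV[R]_n * measurableTypeR R) :=
  (f xu.1 * (phi (xu.1 + xu.2 *: e) * ind xu.2))%:E.
have mphiu : measurable_fun setT
    (fun xu : 'rV[R]_n * measurableTypeR R => phi (xu.1 + xu.2 *: e)).
  have := measurableT_comp mphi (measurable_shift_line 1).
  by congr measurable_fun; apply/funext => z /=; rewrite mul1r.
have mH : measurable_fun setT H.
  apply/measurable_EFinP; apply: measurable_funM; first exact: (measurableT_comp mf).
  by apply: measurable_funM => //; exact: (measurableT_comp measurable_ind).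
have flty : (\int[leb]_x `|(f x)%:E| < +oo)%E by have [] := integrableP _ _ _ fi.
have iH : (leb \x leb1)%E.-integrable setT H.
  apply/integrable12ltyP => //.
  apply: (@le_lt_trans _ _ (\int[leb]_x (t%:E * `|(f x)%:E|))%E); last first.
    rewrite ge0_integralZl//; last first.
      by apply: measurableT_comp => //; apply/measurable_EFinP; exact: mf.
    by rewrite lte_mul_pinfty.
  apply: ge0_le_integral => //.
  - by move=> x _; exact: integral_ge0.
  - apply: (measurable_fun_fubini_tonelli_F (abse \o H)) => //.
    by apply: measurableT_comp.
    by move=> x; exact: abse_ge0.
  - apply: measurable_funeM; apply: measurableT_comp => //.
    by apply/measurable_EFinP; exact: mf.
  - move=> x _; rewrite -integral_ind -ge0_integralZr//; last 2 first.
    + by apply/measurable_EFinP; exact: measurable_ind.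
    + by move=> u _; rewrite lee_fin ind_ge0.
    apply: ge0_le_integral => //.
    + apply: measurableT_comp => //.
      exact: measurableT_comp mH (measurable_pair1 x).
    + apply: emeasurable_funM => //; apply/measurable_EFinP; exact: measurable_ind.
    + move=> u _; rewrite /H /= lee_fin !normrM mulrC ler_wpM2r//.
      by rewrite (ger0_norm (ind_ge0 u)) ler_piMl// ind_ge0.
transitivity (\int[leb]_z \int[leb1]_u H2 (z, u))%E.
  apply: ae_eq_integral => //.
  - apply/measurable_EFinP; apply: measurable_funM => //.
    by apply/measurable_EFinP; exact: measurable_int integrable_slide.
  - exact: (measurable_fubini_F iH2).
  have := slide_fine; have := ae_integrable1 integrable_kern.
  apply: filterS2 => z /= iz sz _.
  rewrite EFinM sz /F /H2/=; under [RHS]eq_integral do rewrite EFinM.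
  by rewrite integralZr.
rewrite (Fubini iH2).
transitivity (\int[leb1]_u \int[leb]_x H (x, u))%E; last first.
  rewrite -(Fubini iH).
  apply: eq_integral => x _; rewrite /H/=.
  under eq_integral do rewrite EFinM.
  rewrite integralZl//; apply: (le_integrable measurableT _ _ integrable_ind).
  - apply/measurable_EFinP; apply: measurable_funM; last exact: measurable_ind.
    exact: measurableT_comp mphiu (measurable_pair1 x).
  - by move=> u _; rewrite lee_fin normrM ler_piMl.
have := ae_integrable2 iH => aH.
apply: ae_eq_integral => //.
- exact: (measurable_fubini_G iH2).
- exact: (measurable_fubini_G iH).
apply: filterS aH => u /= iu _.
rewrite -(@integral_preserving _ _ _ leb (fun z : 'rV[R]_n => z - u *: e)
  (measurable_shift _) (shift_line_preserving u) _ iu).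
apply: eq_integral => z _; rewrite /H2 /H/= /kern subrK.
by congr EFin; ring.
Qed.

End slide.

Section weak_difference.
Variables (R : realType) (n : nat) (Omega : set 'rV[R]_n).
Variables (v : 'rV[R]_n -> R) (G : 'rV[R]_n -> 'rV[R]_n) (i : 'I_n) (t : R).
Local Notation leb := (@lebesgue_rV R n).
Local Notation leb1 := (@lebesgue_measure R).
Let e : 'rV[R]_n := delta_mx ord0 i.
Let w := v \_ Omega.
Let g := (fun x => G x ord0 i) \_ Omega.
Hypotheses (vG : is_L2_weak_gradient Omega v G)
  (wi : leb.-integrable setT (EFin \o w)) (gi : leb.-integrable setT (EFin \o g))
  (t0 : 0 <= t).

(** It contains every segment from [z] to [z + t e_i] with [z] in [box a b]. It is closed because it
    has to contain the whole support of a test function. *)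
Definition swept_box (a b : 'I_n -> R) : set 'rV[R]_n :=
  [set x | forall j, a j <= x ord0 j <= b j + (if j == i then t else 0)].

Let cut (a b : 'I_n -> R) k j : R -> R := cutoff (a j) (b j) k.

Lemma integrableM_le1 (f phi : 'rV[R]_n -> R) :
  leb.-integrable setT (EFin \o f) ->
  measurable_fun setT phi -> (forall x, `|phi x| <= 1) ->
  leb.-integrable setT (fun x => (f x * phi x)%:E).
Proof.
move=> fi mphi phi1; apply: (le_integrable measurableT _ _ fi).
  apply/measurable_EFinP; apply: measurable_funM => //.
  by apply/measurable_EFinP; exact: measurable_int fi.
by move=> x _; rewrite lee_fin normrM ler_piMr.
Qed.

Lemma prodf_cut_ge0 a b k x : 0 <= prodf (cut a b k) x.
Proof. by apply: prodr_ge0 => j _; exact: cutoff_ge0. Qed.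

Lemma prodf_cut_le1 a b k x : `|prodf (cut a b k) x| <= 1.
Proof.
rewrite ger0_norm ?prodf_cut_ge0//; apply: prodr_ile1 => j _.
by rewrite cutoff_ge0 cutoff_le1.
Qed.

Lemma measurable_prodf_cut a b k : measurable_fun setT (prodf (cut a b k)).
Proof. by apply: measurable_prodf => j; exact: smooth_cutoff. Qed.

Lemma coord_line x (s : R) j :
  (x + s *: e) ord0 j = x ord0 j + (if j == i then s else 0).
Proof. by rewrite !mxE eqxx /=; case: (j == i); rewrite ?mulr1 ?mulr0. Qed.

(* Test the weak gradient against the product of cutoffs whose i-th factor is
   replaced by its sliding integral [window], so that the i-th partial
   derivative is a difference of two translates of the product of cutoffs. *)
Lemma weak_difference_test a b k : swept_box a b `<=` Omega ->
  (\int[leb]_z ((w (z + t *: e)%R - w z) * prodf (cut a b k) z)%:E =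
   \int[leb]_z (slide g e t z * prodf (cut a b k) z)%:E)%E.
Proof.
move=> abO.
set c := cut a b k; pose W := window (c i) t.
have sc j : smooth (c j) by exact: smooth_cutoff.
have c0 j x : ~~ (a j < x < b j) -> c j x = 0 by exact: cutoff_eq0.
have sW : smooth W by exact: (smooth_window (sc i) (c0 i) t).
pose psi := prodf (updf c i W).
have tpsi : test_function Omega psi.
  apply: (@test_function_prodf _ _ _ _ a
    (fun j => b j + (if j == i then t else 0))) => //.
    by move=> j; rewrite /updf; case: ifP.
  move=> j x; rewrite /updf; case: ifPn => [/eqP ->|ji]; last first.
    by rewrite addr0; exact: c0.
  exact: (window_eq0 (sc i) (c0 i) t0).
have lineE x (s : R) : prodf c (x + s *: e) =
    c i (x ord0 i + s) * \prod_(j | j != i) c j (x ord0 j).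
  rewrite (prodfD1 _ i) coord_line eqxx; congr (_ * _).
  by apply: eq_bigr => j /negbTE ji; rewrite coord_line ji addr0.
have prodcE x : prodf c x = c i (x ord0 i) * \prod_(j | j != i) c j (x ord0 j).
  by rewrite -{1}(addr0 x) -(scale0r e) lineE addr0.
have partialE x : partial i psi x = prodf c x - prodf c (x + (- t) *: e).
  have := @is_derive_prodf _ _ (updf c i W) i x (fun s => c i s - c i (s - t)).
  rewrite {1}/updf eqxx => /(_ _)[].
    exact: (is_derive_window (sc i) (c0 i) t (x ord0 i)).
  move=> _ dpsi; rewrite /partial dpsi (prodfD1 _ i) {1}/updf eqxx prodcE lineE.
  rewrite -mulrBl.
  by congr (_ * _); apply: eq_bigr => j /negbTE ji; rewrite /updf ji.
(* The test function is itself a sliding integral of the product of cutoffs, the form that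
   [integral_slideM] produces on the gradient side. *)
have psiE x : ((psi x)%:E =
    \int[leb1]_u (prodf c (x + u *: e)%R * \1_`](- t)%R, 0%R] u)%:E)%E.
  rewrite /psi (prodfD1 _ i) /updf eqxx mulrC EFinM.
  rewrite (windowE (sc i) (c0 i))// -ge0_integralZl//; first last.
  - by rewrite lee_fin; apply: prodr_ge0 => j /negbTE ->; exact: cutoff_ge0.
  - by move=> u _; rewrite lee_fin; exact: cutoff_ge0.
  - apply/measurable_EFinP; apply: (measurableT_comp (smooth_measurable (sc i))).
    exact: measurable_funD.
  rewrite integral_mkcond; apply: eq_integral => u _.
  rewrite patchE lineE; case: ifPn => uI.
    rewrite indicE uI mulr1 -EFinM mulrC; congr (_ * _)%:E.
    by apply: eq_bigr => j /negbTE ->.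
  by rewrite indicE (negbTE uI) mulr0.
have restrictM (f h : 'rV[R]_n -> R) :
    (\int[leb]_(x in Omega) (f x * h x)%:E =
     \int[leb]_x ((f \_ Omega) x * h x)%:E)%E.
  rewrite integral_mkcond; apply: eq_integral => x _; rewrite !patchE.
  by case: ifP => // _; rewrite mul0r.
have [_ /(_ _ tpsi)] := vG i.
rewrite (restrictM v) (restrictM (fun x => G x ord0 i)) -/w -/g.
have mphi : measurable_fun setT (prodf c) by exact: measurable_prodf_cut.
have phi1 x : `|prodf c x| <= 1 by exact: prodf_cut_le1.
have mphit : measurable_fun setT (fun x : 'rV[R]_n => prodf c (x + (- t) *: e)).
  exact: measurableT_comp mphi (measurable_shift _).
have iw := integrableM_le1 wi mphi phi1.
have iwt := integrableM_le1 wi mphit (fun x => phi1 _).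
have te_preserving A : measurable A ->
  leb ((fun z : 'rV[R]_n => z + t *: e) @^-1` A) = leb A by exact: lebesgue_rV_shift.
have iwt' := integrable_preserving (measurable_shift (t *: e)) te_preserving iwt.
(* Translation by [t e] turns the backward difference carried by the cutoffs into the forward
   difference of [w]. *)
have Et := integral_preserving (measurable_shift (t *: e)) te_preserving iwt.
under eq_integral => x _ do rewrite partialE mulrBr EFinB.
rewrite (integralB measurableT iw iwt) => Ew.
rewrite (integral_slideM e gi t0 mphi phi1).
under [RHS]eq_integral => x _ do rewrite -psiE -EFinM.
have cancelt (x : 'rV[R]_n) : x + t *: e + (- t) *: e = x.
  by rewrite scaleNr addrK.
move: Et iwt'; rewrite /comp/=; under eq_integral do rewrite cancelt.
under [X in integrable _ _ X]eq_fun do rewrite cancelt.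
move=> Et iwt'; have Ediff := integralB measurableT iwt' iw.
transitivity (\int[leb]_x ((fun x => (w (x + t *: e)%R * prodf c x)%:E) \-
    (fun x => (w x * prodf c x)%:E)) x)%E.
  by apply: eq_integral => x _; rewrite /= mulrBl EFinB.
rewrite Ediff Et.
have := congr1 oppe Ew; rewrite oppeK => <-.
rewrite fin_num_oppeB; first by rewrite addeC.
exact: integrable_fin_num.
Qed.


(** As the cutoffs tend to the indicator of a box, dominated convergence makes the defect [f]
    integrate to 0 over every box whose swept box lies in Omega. Sub-boxes inherit this condition,
    so [ae_eq0_boxes] applies. *)
Lemma weak_difference (a b : 'I_n -> R) : swept_box a b `<=` Omega ->
  {ae leb, forall z, box a b z -> w (z + t *: e) - w z = slide g e t z}.
Proof.
move=> abO.
pose f z := w (z + t *: e) - w z - slide g e t z.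
have te_preserving A : measurable A ->
  leb ((fun z : 'rV[R]_n => z + t *: e) @^-1` A) = leb A by exact: lebesgue_rV_shift.
have fi : leb.-integrable setT (EFin \o f).
  have iwt := integrable_preserving (measurable_shift (t *: e)) te_preserving wi.
  exact: (integrableB measurableT (integrableB measurableT iwt wi)
    (integrable_slide e gi t0)).
have f0 a' b' : swept_box a' b' `<=` Omega ->
    (\int[leb]_(z in box a' b') (f z)%:E = 0)%E.
  move=> abO'.
  have fk0 k : (\int[leb]_z (f z * prodf (cut a' b' k) z)%:E = 0)%E.
    have iwt := integrable_preserving (measurable_shift (t *: e)) te_preserving wi.
    have mphi := measurable_prodf_cut a' b' k.
    have phi1 := prodf_cut_le1 a' b' k.
    have i1 := integrableM_le1 (integrableB measurableT iwt wi) mphi phi1.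
    have i2 := integrableM_le1 (integrable_slide e gi t0) mphi phi1.
    transitivity (\int[leb]_x
      ((fun z => ((w (z + t *: e) - w z)%R * prodf (cut a' b' k) z)%:E) \-
       (fun z => (slide g e t z * prodf (cut a' b' k) z)%:E)) x)%E.
      by apply: eq_integral => x _; rewrite /f /= mulrBl EFinB.
    rewrite integralB// weak_difference_test// subee//.
    exact: integrable_fin_num.
  have mf : measurable_fun setT f.
    by apply/measurable_EFinP; exact: measurable_int fi.
  have cvgp z : prodf (cut a' b' k) z @[k --> \oo] --> (\1_(box a' b') z : R).
    have -> : \1_(box a' b') z = \prod_j ((a' j < z ord0 j < b' j)%R : nat)%:R :> R.
      have [zab|zab] := pselect (box a' b' z).
        by rewrite indicE mem_set// big1// => j _; rewrite zab.
      have [j /negP/negbTE jN] : exists j, ~ (a' j < z ord0 j < b' j).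
        exact/existsNP.
      by rewrite indicE memNset// (bigD1 j)//= jN mul0r.
    rewrite /prodf; elim: (index_enum _) => [|j s IH].
      rewrite big_nil; under eq_fun do rewrite big_nil.
      exact: cvg_cst.
    rewrite big_cons; under eq_fun do rewrite big_cons.
    by apply: cvgM => //; exact: cvg_cutoff.
  have mlim : measurable_fun setT (fun z => (f z * \1_(box a' b') z)%:E).
    apply/measurable_EFinP; apply: measurable_funM => //; apply: measurable_indic.
    exact: measurable_box.
  have fcvg : {ae leb, forall z, setT z ->
      (f z * prodf (cut a' b' k) z)%:E @[k --> \oo] --> (f z * \1_(box a' b') z)%:E}.
    apply: aeW => z _; apply: cvg_EFin; first exact: nearW.
    by apply: cvgM => //; exact: cvg_cst.
  have fle : {ae leb, forall z k, setT z ->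
      (`|(f z * prodf (cut a' b' k) z)%:E| <= `|(f z)%:E|)%E}.
    by apply: aeW => z k _; rewrite lee_fin normrM ler_piMr// prodf_cut_le1.
  have [_ _] := dominated_convergence measurableT
    (fun k => measurable_int _ (integrableM_le1 fi (measurable_prodf_cut a' b' k)
      (prodf_cut_le1 a' b' k))) mlim fcvg (integrable_abse fi) fle.
  rewrite (_ : [sequence _]_n = cst 0%E); last by apply/funext => k /=; exact: fk0.
  move=> /(cvg_unique (@ereal_hausdorff R) (cvg_cst _))/esym/= E0.
  rewrite integral_mkcond -[RHS]E0.
  apply: eq_integral => z _; rewrite patchE indicE.
  by case: ifPn => _; rewrite ?mulr1 ?mulr0.
have mbox := measurable_box a b.
have : ae_eq leb (box a b) (EFin \o f) (cst 0%E).
  apply: ae_eq0_boxes => //.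
  - exact: integrableS fi.
  - exact: f0.
  - move=> a' b'; rewrite setI_box; apply: f0 => x xab; apply: abO => j.
    have := xab j; rewrite ge_max => /andP[/andP[-> _]] /=.
    by move=> /le_trans; apply; rewrite lerD2r ge_min lexx.
apply: filterS => z /= fz zab; have /eqP := fz zab.
by rewrite eqe subr_eq0 => /eqP.
Qed.

End weak_difference.

(** * Measure of the set of phase jumps *)

Section well.
Variable R : realType.

(* On [a >= -1], a minorant of [a |a|^p - a - (p / 2) (a^2 - 1)], where the
   multipliers make both phases 1 and -1 zeros. *)
Definition well (a : R) : R :=
  if 0 < a then (a - 1) ^+ 2 / 2 else `|1 - a ^+ 2| / 2.

Lemma well_ge0 a : 0 <= well a.
Proof. by rewrite /well; case: ifP => _; rewrite divr_ge0// sqr_ge0. Qed.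

Lemma measurable_well : measurable_fun setT well.
Proof.
rewrite (_ : well = fun a =>
  if (0 < a)%R then (a - 1) ^+ 2 / 2 else `|1 - a ^+ 2| / 2)//.
apply: measurable_fun_ifT => /=.
- exact: measurable_fun_ltr.
- apply: measurable_funM => //; apply: measurable_funX; exact: measurable_funB.
- apply: measurable_funM => //; apply: measurableT_comp => //.
  by apply: measurable_funB => //; exact: measurable_funX.
Qed.

(** Say [a > 0 >= b]. If [a < 1/2] then [well a >= 1/8]; otherwise the jump has size at least
    1/2. *)
Lemma well_jump a b : (0 < a) != (0 < b) ->
  1 <= 8 * well a + 8 * well b \/ 1 / 2 <= `|b - a|.
Proof.
wlog: a b / 0 < a.
  move=> H; have /orP[a0|a0 ab] := orbN (0 < a); first exact: H.
  have b0 : 0 < b by move: ab; rewrite (negbTE a0); case: (0 < b).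
  have [|h|h] := H b a b0; first by rewrite eq_sym.
    by left; rewrite addrC.
  by right; rewrite distrC.
move=> a0; rewrite a0 => b0'; have b0 : b <= 0.
  by rewrite leNgt; move: b0'; case: (0 < b).
have := well_ge0 b; rewrite {1 2}/well a0 => wb.
have [a12|a12] := ltP a (1 / 2); [left|right].
  have : (1 / 2) ^+ 2 <= (a - 1) ^+ 2 by nra.
  by rewrite /well; lra.
by rewrite ler0_norm; lra.
Qed.
End well.

Section jump.
Variables (R : realType) (n : nat) (Omega : set 'rV[R]_n).
Variables (w f : 'rV[R]_n -> R) (e : 'rV[R]_n) (t : R) (D : set 'rV[R]_n).
Local Notation leb := (@lebesgue_rV R n).
Local Notation leb1 := (@lebesgue_measure R).
Hypotheses (mO : measurable Omega) (mD : measurable D) (t0 : 0 < t).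
Hypotheses (mw : measurable_fun setT w)
  (fi : leb.-integrable setT (EFin \o f)).
Hypotheses (DO : D `<=` Omega) (DtO : forall z, D z -> Omega (z + t *: e)).
Hypothesis w_slide :
  {ae leb, forall z, D z -> w (z + t *: e) - w z = slide f e t z}.

Let ind : R -> R := \1_`]- t, 0%R].

Let S z := (\int[leb1]_u (f (z - u *: e)%R ^+ 2 * ind u)%:E)%E.

Let mf : measurable_fun setT f.
Proof. by apply/measurable_EFinP; exact: measurable_int fi. Qed.

Let measurable_sqr_kern : measurable_fun setT
  (fun zu : 'rV[R]_n * measurableTypeR R =>
    (f (zu.1 - zu.2 *: e)%R ^+ 2 * ind zu.2)%:E).
Proof.
apply/measurable_EFinP; apply: measurable_funM; last first.
  exact: (measurableT_comp (measurable_ind t)).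
apply: measurable_funX; apply: (measurableT_comp mf).
have := measurable_shift_line e (-1).
by congr measurable_fun; apply/funext => z /=; rewrite mulN1r scaleNr.
Qed.

Let measurable_S : measurable_fun setT S.
Proof.
apply: (measurable_fun_fubini_tonelli_F (fun zu : 'rV[R]_n * measurableTypeR R =>
  (f (zu.1 - zu.2 *: e)%R ^+ 2 * ind zu.2)%:E)) => //.
by move=> x; rewrite lee_fin mulr_ge0 ?sqr_ge0// ind_ge0.
Qed.

Let S_ge0 z : (0 <= S z)%E.
Proof.
by apply: integral_ge0 => u _; rewrite lee_fin mulr_ge0 ?sqr_ge0// ind_ge0.
Qed.

Let integral_S : (\int[leb]_z S z = t%:E * \int[leb]_x (f x ^+ 2)%:E)%E.
Proof.
rewrite (fubini_tonelli (fun zu : 'rV[R]_n * measurableTypeR R =>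
  (f (zu.1 - zu.2 *: e)%R ^+ 2 * ind zu.2)%:E)) //=; last first.
  by move=> x; rewrite lee_fin mulr_ge0 ?sqr_ge0// ind_ge0.
have mf2 : measurable_fun setT (fun x => (f x ^+ 2)%:E).
  by apply/measurable_EFinP; exact: measurable_funX.
have If0 : (0 <= \int[leb]_x (f x ^+ 2)%:E)%E.
  by apply: integral_ge0 => x _; rewrite lee_fin sqr_ge0.
rewrite -(integral_ind (ltW t0)) -ge0_integralZr//; last first.
  by apply/measurable_EFinP; exact: measurable_ind.
apply: eq_integral => u _.
under eq_integral do rewrite EFinM.
rewrite ge0_integralZr//; first last.
- by rewrite lee_fin ind_ge0.
- by move=> x _; rewrite lee_fin sqr_ge0.
- exact: measurableT_comp mf2 (measurable_shift (- (u *: e))).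
rewrite muleC; congr (_ * _)%E.
apply: (@ge0_integral_preserving _ _ _ leb (fun z : 'rV[R]_n => z - u *: e)
  (measurable_shift _) (shift_line_preserving _ u) (fun x => (f x ^+ 2)%:E)) => //.
by move=> x; rewrite lee_fin sqr_ge0.
Qed.

(* AM-GM: |f| <= 1/(4t) + t f^2 *)
Let slide_le z : (`|slide f e t z|%:E <= (1 / 4)%:E + t%:E * S z)%E.
Proof.
have mk : measurable_fun setT (fun u : measurableTypeR R => kern f e t z u).
  exact: measurableT_comp (measurable_kern e t fi) (measurable_pair1 z).
apply: (@le_trans _ _ (\int[leb1]_u `|(kern f e t z u)%:E|)%E).
  apply: le_trans (le_abse_integral _ measurableT _); last exact/measurable_EFinP.
  rewrite /slide /Rintegral.
  by case: (\int[_]_u _)%E => [r||] //=; rewrite normr0 leey.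
have mS : measurable_fun setT
    (fun u : measurableTypeR R => (f (z - u *: e)%R ^+ 2 * ind u)%:E).
  exact: measurableT_comp measurable_sqr_kern (measurable_pair1 z).
have -> : ((1 / 4)%:E = \int[leb1]_u ((1 / (4 * t))%:E * (ind u)%:E))%E.
  rewrite ge0_integralZl//; last 3 first.
  - by apply/measurable_EFinP; exact: measurable_ind.
  - by move=> u _; rewrite lee_fin ind_ge0.
  - by rewrite lee_fin divr_ge0// mulr_ge0// ltW.
  rewrite (integral_ind (ltW t0)) -EFinM; congr EFin; field.
  by rewrite gt_eqF.
rewrite -ge0_integralZl//; last 2 first.
- by move=> u _; rewrite lee_fin mulr_ge0 ?sqr_ge0// ind_ge0.
- by rewrite lee_fin ltW.
rewrite -ge0_integralD//; last 4 first.
- move=> u _; rewrite -EFinM lee_fin mulr_ge0 ?ind_ge0//.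
  by rewrite divr_ge0// mulr_ge0// ltW.
- by apply: measurable_funeM; apply/measurable_EFinP; exact: measurable_ind.
- move=> u _; rewrite -EFinM lee_fin mulr_ge0 ?(ltW t0)//.
  by rewrite mulr_ge0 ?sqr_ge0// ind_ge0.
- exact: measurable_funeM.
apply: ge0_le_integral => //.
- by apply: measurableT_comp => //; exact/measurable_EFinP.
- apply: emeasurable_funD; last exact: measurable_funeM.
  by apply: measurable_funeM; apply/measurable_EFinP; exact: measurable_ind.
move=> u _; rewrite /kern /= -/ind normrM (ger0_norm (ind_ge0 _ _)).
rewrite -!EFinM -EFinD lee_fin.
rewrite mulrA -mulrDl ler_wpM2r ?ind_ge0// -real_normK ?num_real//.
set a := `|_|; rewrite -subr_ge0.
have -> : 1 / (4 * t) + t * a ^+ 2 - a = t * (a - 1 / (2 * t)) ^+ 2.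
  by field; rewrite gt_eqF.
by rewrite mulr_ge0 ?sqr_ge0// ltW.
Qed.

Lemma jump_measure :
  (leb (D `&` [set z | ((0 < w z) != (0 < w (z + t *: e)))%R]) <=
   16%:E * \int[leb]_(x in Omega) (well (w x))%:E +
   (4 * t ^+ 2)%:E * \int[leb]_x (f x ^+ 2)%:E)%E.
Proof.
set J := (X in leb X).
pose q x : \bar R := ((fun x => (well (w x))%:E) \_ Omega) x.
have mq : measurable_fun setT q.
  apply/(measurable_restrictT _ mO)/measurable_funTS/measurable_EFinP.
  exact: measurableT_comp (@measurable_well R) mw.
have q0 x : (0 <= q x)%E.
  by rewrite /q patchE; case: ifP => // _; rewrite lee_fin well_ge0.
have mwt : measurable_fun setT (fun z : 'rV[R]_n => w (z + t *: e)).
  exact: measurableT_comp mw (measurable_shift _).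
have mqt : measurable_fun setT (fun z : 'rV[R]_n => q (z + t *: e)).
  exact: measurableT_comp mq (measurable_shift _).
have mJ : measurable J.
  apply: measurableI => //.
  pose P := [set z | 0 < w z]; pose Pt := [set z : 'rV[R]_n | 0 < w (z + t *: e)].
  have mP (h : 'rV[R]_n -> R) :
      measurable_fun setT h -> measurable [set z | 0 < h z].
    move=> mh; rewrite (_ : [set _ | _] = h @^-1` `]0, +oo[).
      by rewrite -[X in measurable X]setTI; exact: mh.
    by apply/seteqP; split=> z /=; rewrite in_itv/= andbT.
  have -> : [set z : 'rV[R]_n | (0 < w z) != (0 < w (z + t *: e))] =
      (P `\` Pt) `|` (Pt `\` P).
    apply/seteqP; split=> z; rewrite /P /Pt/=.
      by case: (0 < w z); case: (0 < w _) => //; [left|right].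
    by move=> [[-> /negP]|[-> /negP]]; case: (0 < w _).
  by apply: measurableU; apply: measurableD; exact: mP.
(* Chebyshev's inequality is applied to [F], which is at least 1 almost everywhere on [J]: the
   factors 8 come from [well_jump], and a slide of size at least 1/2 forces [t * S z >= 1/4] by
   [slide_le], hence the factor [4 t]. *)
pose F z := (8%:E * q z + 8%:E * q (z + t *: e)%R + (4 * t)%:E * S z)%E.
have F0 z : (0 <= F z)%E.
  by rewrite /F !adde_ge0// mule_ge0// lee_fin// mulr_ge0// ltW.
have mF : measurable_fun setT F.
  by apply: emeasurable_funD; [apply: emeasurable_funD|]; exact: measurable_funeM.
have FE : (\int[leb]_z F z = 16%:E * \int[leb]_(x in Omega) (well (w x))%:E +
   (4 * t ^+ 2)%:E * \int[leb]_x (f x ^+ 2)%:E)%E.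
  rewrite ge0_integralD//; last 4 first.
  - by move=> z _; rewrite adde_ge0// mule_ge0.
  - by apply: emeasurable_funD; exact: measurable_funeM.
  - by move=> z _; rewrite mule_ge0// lee_fin mulr_ge0// ltW.
  - exact: measurable_funeM.
  rewrite ge0_integralD//; last 4 first.
  - by move=> z _; rewrite mule_ge0.
  - exact: measurable_funeM.
  - by move=> z _; rewrite mule_ge0.
  - exact: measurable_funeM.
  rewrite ge0_integralZl// ge0_integralZl// ge0_integralZl//; last first.
    by rewrite lee_fin mulr_ge0// ltW.
  rewrite (@ge0_integral_preserving _ _ _ leb (fun z : 'rV[R]_n => z + t *: e)
    (measurable_shift _) (lebesgue_rV_shift _) q)// integral_S.
  rewrite -ge0_muleDl// -EFinD muleA -EFinM -integral_mkcond.
  by congr (_%:E * _ + _%:E * _)%E; ring.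
rewrite -FE.
apply: (@le_trans _ _ (\int[leb]_(z in J) F z)%E); last first.
  by apply: ge0_subset_integral.
rewrite -[leLHS]mul1e -integral_cst//.
apply: ae_ge0_le_integral => //; first exact: measurable_funTS.
apply: filterS w_slide => z /= wz [Dz jz].
have qz : q z = (well (w z))%:E by rewrite /q patchE mem_set//; exact: DO.
have qzt : q (z + t *: e) = (well (w (z + t *: e)))%:E.
  by rewrite /q patchE mem_set//; exact: DtO.
rewrite /F qz qzt; have [h|h] := well_jump jz.
  rewrite -!EFinM -EFinD.
  apply: (@le_trans _ _ (8 * well (w z) + 8 * well (w (z + t *: e)))%:E).
    by rewrite lee_fin.
  by rewrite leeDl// mule_ge0// lee_fin mulr_ge0// ltW.
have := slide_le z; rewrite -wz// => h'.
have := le_trans _ h' => /(_ (1 / 2)%:E); rewrite lee_fin => /(_ h).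
move: (S_ge0 z); case: (S z) => [s||] //; last first.
  by move=> _ _; rewrite gt0_muley ?lte_fin ?mulr_gt0// -!EFinM -EFinD addey ?leey.
rewrite !lee_fin => s0 h2.
by have := well_ge0 (w z); have := well_ge0 (w (z + t *: e)); lra.
Qed.

End jump.

(** * From small translations to the mass of the phases in a cube *)

Section jumps.
Variables (R : realType) (n : nat) (a : 'rV[R]_n -> bool) (c : 'rV[R]_n) (r : R).
Local Notation leb := (@lebesgue_rV R n).
Hypotheses (ma : measurable [set x | a x]) (r0 : 0 < r).
Implicit Types (h k x : 'rV[R]_n) (i j : 'I_n).

Definition jumps h : set 'rV[R]_n :=
  ball c r `&` [set x | ball c r (x + h)] `&` [set x | a x != a (x + h)].

Let mQ : measurable (ball c r).
Proof. by apply: open_measurable_mx; exact: ball_open. Qed.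

Let measurable_preim_shift h (A : set 'rV[R]_n) : measurable A ->
  measurable [set x | A (x + h)].
Proof.
by move=> mA; have := measurable_shift h measurableT mA; rewrite setTI.
Qed.

Lemma measurable_jumps h : measurable (jumps h).
Proof.
apply: measurableI.
  by apply: measurableI => //; exact: measurable_preim_shift.
have mh := measurable_preim_shift h ma.
rewrite (_ : [set x | _] = ([set x | a x] `\` [set x | a (x + h)]) `|`
    ([set x | a (x + h)] `\` [set x | a x])).
  by apply: measurableU; apply: measurableD.
apply/seteqP; split=> x /=.
  by case: (a x); case: (a _) => //; [left|right].
by move=> [[-> /negP]|[-> /negP]]; case: (a _).
Qed.

(** A phase change across [h + k] occurs across [h] or across [k]. The hypothesis keeps the
    intermediate point in the cube, and translation invariance accounts for the second step starting
    at [x + h]. *)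
Lemma jumpsD_le h k :
  (forall x, ball c r x -> ball c r (x + h + k) -> ball c r (x + h)) ->
  (leb (jumps (h + k)) <= leb (jumps h) + leb (jumps k))%E.
Proof.
move=> Qhk; rewrite -(lebesgue_rV_shift h (measurable_jumps k)).
have mk : measurable ((fun x => x + h) @^-1` jumps k).
  by apply: measurable_preim_shift; exact: measurable_jumps.
apply: le_trans (measureU2 _ (measurable_jumps h) mk).
apply: le_measure; rewrite ?inE; [exact: measurable_jumps| |].
  by apply: measurableU => //; exact: measurable_jumps.
move=> x [[Qx /= Qxhk]]; rewrite addrA in Qxhk *.
have Qxh := Qhk x Qx Qxhk; have [axh|axh] := eqVneq (a x) (a (x + h)).
  by rewrite axh => ?; right.
by move=> _; left.
Qed.

Lemma jumpsN h : leb (jumps (- h)) = leb (jumps h).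
Proof.
rewrite -[RHS](lebesgue_rV_shift (- h))//; last exact: measurable_jumps.
congr (leb _); apply/seteqP.
by split=> x; rewrite /preimage /jumps /setI /= subrK => -[[Qx Qxh] ax];
  (split; [split|rewrite eq_sym]).
Qed.

Lemma jumps0 : leb (jumps 0) = 0%E.
Proof.
rewrite (_ : jumps 0 = set0) ?measure0//; apply/seteqP; split=> // x [_ /=].
by rewrite addr0 eqxx.
Qed.

(** When [h] and [k] never have opposite signs in a coordinate, [x + h] lies between [x] and
    [x + h + k] coordinatewise, and a cube is a product of intervals. *)
Lemma ball_between h k x : (forall j, 0 <= h ord0 j * k ord0 j) ->
  ball c r x -> ball c r (x + h + k) -> ball c r (x + h).
Proof.
move=> hk [_ Qx] [_ Qxhk]; split=> // i j; move: (Qx i j) (Qxhk i j) (hk j).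
rewrite (ord1 i) /ball/= !mxE !ltr_norml => /andP[h1 h2] /andP[h3 h4] h5.
have [h0|h0] := leP 0 (h ord0 j).
  have [k0|k0] := leP 0 (k ord0 j); first by apply/andP; split; lra.
  have h00 : h ord0 j = 0 by nra.
  by rewrite h00; apply/andP; split; lra.
have k0 : k ord0 j <= 0 by nra.
by apply/andP; split; lra.
Qed.

Lemma jumps_natmul m h : (leb (jumps (m%:R *: h)) <= m%:R%:E * leb (jumps h))%E.
Proof.
elim: m => [|m IH]; first by rewrite scale0r jumps0 mul0e.
rewrite -natr1 scalerDl scale1r.
apply: (le_trans (jumpsD_le _)).
  move=> x; apply: ball_between => j; rewrite mxE.
  by rewrite -mulrA mulr_ge0// -expr2 sqr_ge0.
by rewrite EFinD ge0_muleDl ?lee_fin// mul1e leeD2r.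
Qed.

Section small_steps.
Variables (tau B : R).
Hypotheses (tau0 : 0 < tau) (B0 : 0 <= B).
Hypothesis jumps_small : forall i (t : R), 0 < t <= tau ->
  (leb (jumps (t *: delta_mx ord0 i)) <= B%:E)%E.

(** Up to sign, [s] is cut into [m] equal steps, where [m] is the integer part of [s / tau] plus 1:
    this makes each step at most [tau], with [m] at most [2 r / tau + 1]. *)
Lemma jumps_axis i (s : R) : `|s| <= 2 * r ->
  (leb (jumps (s *: delta_mx ord0 i)) <= ((2 * r / tau + 1) * B)%:E)%E.
Proof.
wlog: s / 0 <= s.
  move=> H sr; have [s0|s0] := leP 0 s; first exact: H.
  rewrite -jumpsN -scaleNr; apply: H; last by rewrite normrN.
  by rewrite oppr_ge0 ltW.
move=> s0; rewrite ger0_norm// => sr.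
have C0 : 0 <= 2 * r / tau + 1 by rewrite addr_ge0// divr_ge0 ?mulr_ge0// ltW.
have [->|sn0] := eqVneq s 0.
  by rewrite scale0r jumps0 lee_fin mulr_ge0.
have sgt0 : 0 < s by rewrite lt_neqAle eq_sym sn0.
pose m := (Num.truncn (s / tau)).+1.
have sm : s = m%:R * (s / m%:R) by rewrite mulrC divfK// pnatr_eq0.
have mle : m%:R <= 2 * r / tau + 1.
  rewrite /m -natr1 lerD2r; apply: (@le_trans _ _ (s / tau)).
    by rewrite truncn_le// divr_ge0 ?ltW.
  by rewrite ler_pM2r ?invr_gt0.
rewrite sm -scalerA; apply: (le_trans (jumps_natmul _ _)).
apply: (@le_trans _ _ (m%:R%:E * B%:E)%E).
  rewrite lee_wpmul2l ?lee_fin//; apply: jumps_small.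
  rewrite divr_gt0 ?ltr0n//= ler_pdivrMr ?ltr0n// mulrC -ler_pdivrMr//.
  by rewrite ltW// truncnS_gt.
by rewrite -EFinM lee_fin ler_wpM2r.
Qed.

(** Translate along one axis at a time. Since the axes are distinct, the path is monotone in each
    coordinate and stays in the cube between its endpoints. *)
Lemma jumps_le h : (forall j, `|h ord0 j| <= 2 * r) ->
  (leb (jumps h) <= (n%:R * ((2 * r / tau + 1) * B))%:E)%E.
Proof.
move=> hr; set M := (_ * B).
suff H (s : seq 'I_n) : uniq s ->
    (leb (jumps (\sum_(i <- s) h ord0 i *: delta_mx ord0 i)) <=
     ((size s)%:R * M)%:E)%E.
  rewrite [h in jumps h]row_sum_delta; have := H _ (enum_uniq 'I_n).
  by rewrite size_enum_ord big_enum.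
elim: s => [_|i s IH /= /andP[iNs us]]; first by rewrite big_nil jumps0 mul0r.
rewrite big_cons; apply: (le_trans (jumpsD_le _)).
  move=> x; apply: ball_between => j; rewrite summxE.
  have [->|ji] := eqVneq j i; last first.
    by rewrite !mxE (negbTE ji) andbF mulr0 mul0r.
  rewrite big_seq big1 ?mulr0// => k ks; rewrite !mxE.
  have /negbTE -> : i != k by apply: contraNneq iNs => ->.
  by rewrite andbF mulr0.
have -> : (size s).+1%:R * M = M + (size s)%:R * M.
  by rewrite -natr1 mulrDl mul1r addrC.
by rewrite EFinD leeD//; [exact: jumps_axis|exact: IH].
Qed.

End small_steps.

(* The product is the measure of pairs [(x, x + h)] of points of the cube in
   opposite phases; integrate over [h] last. *)
Lemma mass_product_le (M : R) : 0 <= M ->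
  (forall h, (forall j, `|h ord0 j| <= 2 * r) -> (leb (jumps h) <= M%:E)%E) ->
  (leb (ball c r `&` [set x | a x]) * leb (ball c r `\` [set x | a x]) <=
   M%:E * leb (ball (0%R : 'rV[R]_n) (2 * r)%R))%E.
Proof.
move=> M0 JM.
set A := ball c r `&` _; set B := _ `\` _.
have mA : measurable A by exact: measurableI.
have mB : measurable B by exact: measurableD.
pose f (xh : 'rV[R]_n * 'rV[R]_n) : \bar R :=
  (\1_A xh.1 * \1_B (xh.1 + xh.2))%:E.
have mI : measurable_fun setT (\1_B : 'rV[R]_n -> R) by exact: measurable_indic.
have mf : measurable_fun setT f.
  apply/measurable_EFinP; apply: measurable_funM.
    by apply: measurableT_comp => //; exact: measurable_indic.
  apply: (measurableT_comp mI).
  exact: measurable_funD_rV.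
have f0 xh : (0 <= f xh)%E by rewrite lee_fin mulr_ge0.
have f1 : (\int[leb]_x \int[leb]_h f (x, h) = leb A * leb B)%E.
  transitivity (\int[leb]_x ((\1_A x)%:E * leb B))%E.
    apply: eq_integral => x _; rewrite /f/=.
    under eq_integral do rewrite EFinM.
    rewrite ge0_integralZl//; last first.
      apply/measurable_EFinP; apply: (measurableT_comp mI).
      exact: measurable_funD_rV.
    congr (_ * _)%E; under eq_integral do rewrite addrC.
    rewrite (@ge0_integral_preserving _ _ _ leb (fun y : 'rV[R]_n => y + x)
      (measurable_shift _) (lebesgue_rV_shift x)
      (EFin \o (\1_B : 'rV[R]_n -> R)))//.
    - by rewrite integral_indic// setIT.
    - by apply/measurable_EFinP; exact: measurable_indic.
    - by move=> y; rewrite lee_fin.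
  rewrite ge0_integralZr//; first by rewrite integral_indic// setIT.
  by apply/measurable_EFinP; exact: measurable_indic.
set Q2 := ball (0 : 'rV[R]_n) (2 * r).
have mb : measurable Q2.
  by apply: open_measurable_mx; exact: ball_open.
rewrite -f1 (fubini_tonelli f)//.
have -> : (M%:E * leb Q2 = \int[leb]_h (M%:E * (\1_Q2 h)%:E))%E.
  rewrite ge0_integralZl//; first by rewrite integral_indic// setIT.
  by apply/measurable_EFinP; exact: measurable_indic.
apply: ge0_le_integral => //.
- by move=> h _; exact: integral_ge0.
- exact: measurable_fun_fubini_tonelli_G.
- by apply: measurable_funeM; apply/measurable_EFinP; exact: measurable_indic.
(* Two points of the cube differ by less than [2 r] in each coordinate, so translations outside
   [ball 0 (2 r)] contribute nothing. *)
move=> h _; rewrite [in leRHS]indicE; have [hb|hb] := boolP (h \in _); last first.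
  rewrite mule0 integral0_eq// => x _; rewrite /f/= !indicE.
  have [xA|] := boolP (x \in A); last by rewrite mul0r.
  have [xB|] := boolP (_ \in B); last by rewrite mulr0.
  move: xA xB; rewrite !inE => -[[_ Qx] _] [[_ Qxh] _].
  case/negP: hb; rewrite inE; split=> [|i j]; first by rewrite mulr_gt0.
  have := Qx i j; have := Qxh i j.
  rewrite /ball/= !mxE !ltr_norml => /andP[? ?] /andP[? ?].
  by apply/andP; split; lra.
rewrite mule1; apply: le_trans (JM h _).
  rewrite -(setIT (jumps h)) -integral_indic//; last exact: measurable_jumps.
  apply: ge0_le_integral => //.
  - exact: measurableT_comp mf (measurable_pair2 h).
  - by apply/measurable_EFinP; apply: measurable_indic; exact: measurable_jumps.
  move=> x _; rewrite /f/= lee_fin !indicE.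
  have [xA|] := boolP (x \in A); last by rewrite mul0r.
  have [xB|] := boolP (_ \in B); last by rewrite mulr0.
  rewrite mem_set ?mulr1//; move: xA xB; rewrite !inE => -[Qx /= ax] [Qxh /= axh].
  by split=> //=; rewrite ax; case: (a (x + h)) axh.
move=> j; move: hb; rewrite inE => -[_ /(_ ord0 j)].
rewrite /ball/= !mxE sub0r normrN.
exact: ltW.
Qed.

End jumps.

(** * Propagation along a connected open set *)

Section dichotomy.
Variables (R : realType) (n : nat) (Omega : set 'rV[R]_n).
Variables (I : Type) (A : I -> set 'rV[R]_n) (delta : I -> R).
Local Notation leb := (@lebesgue_rV R n).
Hypotheses (oO : open Omega) (cO : connected Omega) (O1 : leb Omega = 1%E).
Hypothesis mA : forall i, measurable (A i).
Implicit Types (U V W : set 'rV[R]_n) (b : bool).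

Definition side i b := if b then A i else ~` A i.

(* [settled]: small [delta i] forces U to lie mostly on one side of [A i];
   [linked]: moreover on the same side as V. *)
Definition settled U := forall eta : R, 0 < eta -> exists2 eps : R, 0 < eps &
  forall i, delta i <= eps -> exists b, (leb (U `&` side i b) <= eta%:E)%E.

Definition linked V U := forall eta : R, 0 < eta -> exists2 eps : R, 0 < eps &
  forall i, delta i <= eps -> exists b, (leb (U `&` side i b) <= eta%:E)%E /\
    (leb (V `&` side i b) <= eta%:E)%E.

Lemma measurable_side i b : measurable (side i b).
Proof. by rewrite /side; case: b => //; exact: measurableC. Qed.

(** If [2 m < leb U], the two sides cannot both have measure at most [m] in [U]. This threshold is
    what makes the chosen side unique in the lemmas that follow. *)
Lemma side_conflict U : measurable U -> (0 < leb U)%E -> exists2 m : R, 0 < m &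
  forall i b b', (leb (U `&` side i b) <= m%:E)%E ->
    (leb (U `&` side i b') <= m%:E)%E -> b = b'.
Proof.
move=> mU U0.
have [m m0 mUle] : exists2 m : R, 0 < m & (m%:E + m%:E < leb U)%E.
  case: (leb U) U0 => [u| |//].
    by rewrite lte_fin => u0; exists (u / 3); [lra|rewrite -EFinD lte_fin; lra].
  by move=> _; exists 1 => //; rewrite -EFinD ltry.
exists m => // i b b' h h'; apply/eqP; apply: contraTT mUle => bb'.
rewrite -leNgt (measureDI _ mU (mA i)) addeC.
have -> : U `\` A i = U `&` ~` A i by [].
by move: bb' h h'; case: b; case: b' => // _ h h'; apply: leeD.
Qed.

Lemma linked_trans V U W : measurable U -> (0 < leb U)%E ->
  linked V U -> linked U W -> linked V W.
Proof.
move=> mU U0 VU UW eta eta0; have [m m0 mU'] := side_conflict mU U0.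
have em0 : 0 < Num.min eta m by rewrite lt_min eta0.
have [e1 e10 h1] := VU _ em0; have [e2 e20 h2] := UW _ em0.
exists (Num.min e1 e2); first by rewrite lt_min e10.
move=> i; rewrite le_min => /andP[/h1[b [Ub Vb]] /h2[b' [Wb' Ub']]].
have mine : ((Num.min eta m)%:E <= eta%:E)%E by rewrite lee_fin ge_min lexx.
have minm : ((Num.min eta m)%:E <= m%:E)%E by rewrite lee_fin ge_min lexx orbT.
have bb' := mU' i b b' (le_trans Ub minm) (le_trans Ub' minm).
by exists b; rewrite {1}bb'; split; [apply: le_trans mine|apply: le_trans mine].
Qed.

Lemma linked_overlap V U W : measurable V -> measurable U -> measurable W ->
  (0 < leb W)%E -> W `<=` U `&` V -> settled V -> settled U -> linked V U.
Proof.
move=> mV mU mW W0 WUV sV sU eta eta0; have [m m0 mW'] := side_conflict mW W0.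
have em0 : 0 < Num.min eta m by rewrite lt_min eta0.
have [e1 e10 h1] := sV _ em0; have [e2 e20 h2] := sU _ em0.
exists (Num.min e1 e2); first by rewrite lt_min e10.
move=> i; rewrite le_min => /andP[/h1[b Vb] /h2[b' Ub']].
have mine : ((Num.min eta m)%:E <= eta%:E)%E by rewrite lee_fin ge_min lexx.
have minm : ((Num.min eta m)%:E <= m%:E)%E by rewrite lee_fin ge_min lexx orbT.
have leW X c : measurable X -> W `<=` X ->
    (leb (W `&` side i c) <= leb (X `&` side i c))%E.
  move=> mX WX; apply: le_measure; rewrite ?inE; [| |exact: setSI].
    by apply: measurableI => //; exact: measurable_side.
  by apply: measurableI => //; exact: measurable_side.
have bb' : b = b'.
  apply: (mW' i).
    by apply: le_trans (le_trans Vb minm); apply: leW => // x /WUV[].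
  by apply: le_trans (le_trans Ub' minm); apply: leW => // x /WUV[].
by exists b; rewrite {1}bb'; split; [apply: le_trans mine|apply: le_trans mine].
Qed.

Lemma linkedU V U W : measurable V -> measurable U -> measurable W ->
  (0 < leb V)%E -> linked V U -> linked V W -> linked V (U `|` W).
Proof.
move=> mV mU mW V0 VU VW eta eta0; have [m m0 mV'] := side_conflict mV V0.
have em0 : 0 < Num.min (eta / 2) m by rewrite lt_min divr_gt0.
have [e1 e10 h1] := VU _ em0; have [e2 e20 h2] := VW _ em0.
exists (Num.min e1 e2); first by rewrite lt_min e10.
move=> i; rewrite le_min => /andP[/h1[b [Ub Vb]] /h2[b' [Wb' Vb']]].
have mine : ((Num.min (eta / 2) m)%:E <= (eta / 2)%:E)%E.
  by rewrite lee_fin ge_min lexx.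
have minm : ((Num.min (eta / 2) m)%:E <= m%:E)%E.
  by rewrite lee_fin ge_min lexx orbT.
have bb' := mV' i b b' (le_trans Vb minm) (le_trans Vb' minm).
exists b; split; last first.
  by apply: (le_trans (le_trans Vb mine)); rewrite lee_fin; lra.
rewrite setIUl [eta]splitr EFinD.
apply: le_trans (measureU2 _ _ _) _.
- by apply: measurableI => //; exact: measurable_side.
- by apply: measurableI => //; exact: measurable_side.
by apply: leeD; [exact: le_trans mine|rewrite bb'; exact: le_trans mine].
Qed.

Lemma linked_set0 V : settled V -> linked V set0.
Proof.
move=> sV eta eta0; have [e e0 h] := sV _ eta0; exists e => // i /h[b Vb].
by exists b; rewrite set0I measure0 lee_fin ltW.
Qed.

(** The factor 2 puts the closed cube inside Omega, as the supports of test functions require, and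
    also bounds the measure of the set [ball 0 (2 r)] of translations by that of Omega. *)
Definition good (c : 'rV[R]_n) (r : R) := 0 < r /\ ball c (2 * r) `<=` Omega.

Hypothesis good_settled : forall c r, good c r -> settled (ball c r).

Let mball (c : 'rV[R]_n) r : measurable (ball c r).
Proof. by apply: open_measurable_mx; exact: ball_open. Qed.

Lemma good_sub c r : good c r -> ball c r `<=` Omega.
Proof. by move=> [r0 cr]; apply: subset_trans cr; apply: le_ball; lra. Qed.

Lemma good_exists x : Omega x -> exists r, good x r.
Proof.
move=> Ox; have /nbhs_ballP[e /= e0 eO] : nbhs x Omega by exact: open_nbhs_nbhs.
by exists (e / 2); split; [rewrite divr_gt0|rewrite mulrC divfK].
Qed.

Lemma linked_balls c r c' r' x : good c r -> good c' r' ->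
  ball c r x -> ball c' r' x -> linked (ball c r) (ball c' r').
Proof.
move=> g g' cx c'x.
have : nbhs x (ball c' r' `&` ball c r).
  by apply: filterI; apply: open_nbhs_nbhs; split => //; exact: ball_open.
move=> /nbhs_ballP[e /= e0 eW].
by apply: (linked_overlap _ _ _ _ eW) => //; [exact: lebesgue_rV_ball_gt0|
  exact: good_settled|exact: good_settled].
Qed.

(** Connectedness: the union of the good balls linked to the reference ball and the union of the
    others are open and cover Omega. They are disjoint in Omega, because overlapping good balls are
    linked to each other through the open overlap of positive measure. *)
Lemma good_linked c0 r0 c r : good c0 r0 -> good c r ->
  linked (ball c0 r0) (ball c r).
Proof.
move=> g0 g.
pose lk c r := linked (ball c0 r0) (ball c r).
pose U b := \bigcup_(cr in [set cr | good cr.1 cr.2 /\ (lk cr.1 cr.2 <-> b)])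
  ball cr.1 cr.2.
have oU b : open (U b) by apply: bigcup_open => cr _; exact: ball_open.
have lk_trans c1 r1 c2 r2 x : good c1 r1 -> good c2 r2 ->
    ball c1 r1 x -> ball c2 r2 x -> lk c1 r1 -> lk c2 r2.
  move=> g1 g2 x1 x2 l1; apply: linked_trans l1 _ => //.
    by apply: lebesgue_rV_ball_gt0; case: g1.
  exact: linked_balls x1 x2.
have center c1 r1 : good c1 r1 -> ball c1 r1 c1 by move=> [? _]; exact: ballxx.
have SO : Omega `&` U true = Omega.
  apply: cO.
  - exists c0; split; first exact: good_sub (center _ _ g0).
    exists (c0, r0); last exact: center.
    split => //; split => // _.
    exact: linked_balls (center _ _ g0) (center _ _ g0).
  - by exists (U true).
  - exists (~` U false); first exact: open_closedC.
    apply/seteqP; split=> x [Ox].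
      move=> [[c1 r1] /= [g1 [_ l1]] x1]; split=> // -[[c2 r2] /= [g2 [l2 _]] x2].
      by have := l2 (lk_trans _ _ _ _ _ g1 g2 x1 x2 (l1 isT)).
    move=> NU; split=> //; have [e ge] := good_exists Ox.
    exists (x, e); last exact: center.
    split=> //=; split=> // _; apply: contrapT => nl; apply: NU.
    by exists (x, e); [split|exact: center].
have : (Omega `&` U true) c by rewrite SO; exact: good_sub (center _ _ g).
move=> [_ [[c1 r1] /= [g1 [_ l1]] x1]].
exact: lk_trans x1 (center _ _ g) (l1 _).
Qed.

(** Omega is a countable union of good balls with rational centre and radius, and finitely many of
    them suffice up to [eta] by continuity of the measure from below. *)
Lemma good_cover (eta : R) : 0 < eta -> exists s : seq ('rV[R]_n * R),
  (forall cr, cr \in s -> good cr.1 cr.2) /\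
  (leb (Omega `\` \big[setU/set0]_(cr <- s) ball cr.1 cr.2) <= eta%:E)%E.
Proof.
move=> eta0.
pose T := ('rV[rat]_n * rat)%type.
pose cr (q : T) : 'rV[R]_n * R := (map_mx ratr q.1, ratr q.2).
pose gd (q : T) : bool := `[< good (cr q).1 (cr q).2 >].
(* The list holds at most one ball; it is empty when [k] does not encode a good one. *)
pose sq k : seq T :=
  if unpickle k is Some q then (if gd q then [:: q] else [::]) else [::].
pose F k := \big[setU/set0]_(q <- sq k) ball (cr q).1 (cr q).2.
have sqgd k q : q \in sq k -> good (cr q).1 (cr q).2.
  rewrite /sq; case: unpickle => // q'; case: ifPn => // /asboolP g.
  by rewrite inE => /eqP ->.
have mF k : measurable (F k).
  by rewrite /F; apply: bigsetU_measurable => q _; exact: mball.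
have FO : \bigcup_k F k = Omega.
  apply/seteqP; split=> [x [k _]|x Ox].
    rewrite /F => Fx; have : (\bigcup_(q in [set` sq k]) ball (cr q).1 (cr q).2) x.
      by rewrite bigcup_seq.
    by move=> [q qs]; apply: good_sub; exact: sqgd qs.
  have [e [e0 eO]] := good_exists Ox.
  have [p] := rat_in_itvoo (divr_gt0 e0 (ltr0n R 2)).
  rewrite in_itv/= => /andP[p0 pe].
  have rate (y : R) : exists q : rat, ball (ratr q : R) (ratr p) y.
    have [q] : exists q : rat, ratr q \in `]y - ratr p, y + ratr p[.
      by apply: rat_in_itvoo; rewrite ltrBlDr -addrA ltrDl addr_gt0.
    by rewrite in_itv/= => hq; exists q; rewrite /ball/= ltr_distl.
  have /choice[g hg] := fun i : 'I_n => rate (x ord0 i).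
  pose q : T := (\row_i g i, p).
  have qx : ball (cr q).1 (cr q).2 x.
    by split => // i j; rewrite !mxE (ord1 i).
  have gq : gd q.
    apply/asboolP; split=> // y qy; apply: eO.
    apply: (@le_ball _ _ _ (ratr p + 2 * ratr p)); first by lra.
    by apply: ball_triangle qy; exact: ball_sym.
  by exists (pickle q) => //; rewrite /F /sq pickleK gq big_seq1.
pose U m := \big[setU/set0]_(k < m.+1) F k.
have mU m : measurable (U m) by apply: bigsetU_measurable.
have UO m : U m `<=` Omega.
  by rewrite -FO /U -bigcup_mkord => x [k _ Fx]; exists k.
have [m Um] : exists m, (leb (Omega `\` U m) <= eta%:E)%E.
  apply: contrapT => /forallNP Nle.
  have mO : measurable Omega by exact: open_measurable_mx.
  have cvgU : leb \o U @ \oo --> 1%E.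
    rewrite -O1 -FO -bigcup_bigsetU_bigcup; apply: nondecreasing_cvg_mu => //.
    - exact: bigcup_measurable.
    - apply/nondecreasing_seqP => k; apply/subsetPset.
      by rewrite /U [in X in _ `<=` X]big_ord_recr/=; exact: subsetUl.
  have : (1 <= (1 - eta)%:E :> \bar R)%E.
    apply: cvge_le cvgU; apply: nearW => m /=.
    have E1 : (1 = leb (Omega `\` U m) + leb (U m))%E.
      by rewrite -O1 (measureDI _ mO (mU m)) setIidr.
    have /negP := Nle m; rewrite -ltNge.
    have Ufin : leb (U m) \is a fin_num.
      rewrite ge0_fin_numE//; apply: (@le_lt_trans _ _ 1%E); last exact: ltry.
      by rewrite E1 leeDr.
    have Dfin : leb (Omega `\` U m) \is a fin_num.
      rewrite ge0_fin_numE//; apply: (@le_lt_trans _ _ 1%E); last exact: ltry.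
      by rewrite E1 leeDl.
    move: E1; rewrite -(fineK Ufin) -(fineK Dfin) -EFinD => -[E1].
    by rewrite lte_fin lee_fin E1; lra.
  by rewrite lee_fin; lra.
exists [seq cr q | q <- flatten [seq sq k | k <- iota 0 m.+1]]; split.
  move=> _ /mapP[q + ->]; case/flattenP => _ /mapP[k _ ->]; exact: sqgd.
rewrite big_map big_flatten big_map -[iota 0 m.+1]/(index_iota 0 m.+1) big_mkord.
exact: Um.
Qed.

(** Finitely many good balls, all linked to one reference ball, cover Omega up to [eta / 2]; their
    union then lies on a common side up to another [eta / 2]. *)
Theorem connected_dichotomy (eta : R) : 0 < eta -> exists2 eps : R, 0 < eps &
  forall i, delta i <= eps -> exists b, (leb (Omega `&` side i b) <= eta%:E)%E.
Proof.
move=> eta0.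
have [x0 Ox0] : Omega !=set0.
  apply/set0P/eqP => O0; have := O1; rewrite O0 measure0 => /eqP.
  by rewrite eqe eq_sym oner_eq0.
have [r0 g0] := good_exists Ox0.
have eta20 : 0 < eta / 2 by rewrite divr_gt0.
have [s [sg sU]] := good_cover eta20.
set U := \big[setU/set0]_(_ <- s) _ in sU.
have [mU lU] : measurable U /\ linked (ball x0 r0) U.
  rewrite /U; elim: s sg {sU U} => [_|cr s IH sg].
    by rewrite big_nil; split => //; apply: linked_set0; exact: good_settled.
  have [mU lU] := IH (fun cr crs => sg cr (mem_behead (s := _ :: _) crs)).
  rewrite big_cons; split; first exact: measurableU.
  apply: linkedU => //; first by apply: lebesgue_rV_ball_gt0; case: g0.
  by apply: good_linked => //; apply: sg; rewrite mem_head.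
have [eps eps0 h] := lU _ eta20; exists eps => // i /h[b [Ub _]]; exists b.
have mO : measurable Omega by exact: open_measurable_mx.
apply: (@le_trans _ _ (leb ((U `&` side i b) `|` (Omega `\` U))))%E.
  apply: le_measure; rewrite ?inE.
  - by apply: measurableI => //; exact: measurable_side.
  - apply: measurableU; last exact: measurableD.
    by apply: measurableI => //; exact: measurable_side.
  - by move=> x [Ox sx]; have [Ux|Ux] := pselect (U x); [left|right].
apply: (le_trans (measureU2 _ _ _)).
- by apply: measurableI => //; exact: measurable_side.
- exact: measurableD.
by rewrite [eta]splitr EFinD leeD.
Qed.

End dichotomy.

(** * The energy bound *)

Section pointwise.
Variable R : realType.

(** Vanishing at 1 and -1 together with tangency at 1 forces the multipliers 1 and [p / 2]. For
    [a > 0] the bound reduces to [a^(p+1) >= a^2 + (p-1)/2 (a^2-1)], obtained from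
    [a^(p-1) >= 1 + (p-1) ln a] and [2 a^2 ln a >= a^2 - 1]. For [a <= 0] the difference is
    [s (1 - s^p) + (p-1)/2 (1 - s^2)] with [s = -a] in [[0, 1]]. *)
Lemma well_le (p a : R) : 1 < p -> -1 <= a ->
  a + p / 2 * (a ^+ 2 - 1) + well a <= a * `|a| `^ p.
Proof.
move=> p1 a1; rewrite /well; case: ifPn => [a0|]; last first.
  rewrite -leNgt => a0; rewrite (ler0_norm a0).
  have sp0 := powR_ge0 (- a) p.
  have sp1 : (- a) `^ p <= 1.
    have : (- a) `^ p <= 1 `^ p by apply: ge0_ler_powR; rewrite ?nnegrE; lra.
    by rewrite powR1.
  have sq1 : a ^+ 2 <= 1 by nra.
  rewrite (@ger0_norm _ (1 - a ^+ 2)); last by lra.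
  have h1 : 0 <= (p - 1) * (1 - a ^+ 2) by apply: mulr_ge0; lra.
  have h2 : 0 <= - a * (1 - (- a) `^ p) by apply: mulr_ge0; lra.
  by lra.
rewrite gtr0_norm// -mulr_powRB1//; [|exact: ltW|exact: lt_trans p1].
have pE : 1 + (p - 1) * ln a <= a `^ (p - 1).
  by rewrite /powR gt_eqF//; exact: expR_ge1Dx.
have lnE : a ^+ 2 - 1 <= 2 * a ^+ 2 * ln a.
  have := expR_ge1Dx (- (ln a *+ 2)).
  rewrite mulr2n expRN expRD lnK ?posrE// -expr2 => h.
  have a20 : 0 < a ^+ 2 by rewrite exprn_gt0.
  have := ler_wpM2l (ltW a20) h; rewrite divff ?gt_eqF// => {}h.
  lra.
have h1 := ler_wpM2l (sqr_ge0 a) pE.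
have h2 : 0 <= (p - 1) * (2 * a ^+ 2 * ln a - (a ^+ 2 - 1)).
  by apply: mulr_ge0; lra.
by rewrite mulrA -expr2; lra.
Qed.

(** Near 1 the well is quadratic, and AM-GM costs the constant 1/8. Near -1 it is linear:
    [|a + 1| <= |1 - a^2|] for [a <= 0]. *)
Lemma well_near_phase (a : R) :
  `|a - (if 0 < a then 1 else -1)| <= (0 < a)%R%:R / 8 + 4 * well a.
Proof.
rewrite /well ler_norml; case: ifPn => a0 /=.
  have h1 : 0 <= (a - 1 - 1 / 4) ^+ 2 by exact: sqr_ge0.
  have h2 : 0 <= (a - 1 + 1 / 4) ^+ 2 by exact: sqr_ge0.
  by apply/andP; split; nra.
rewrite -leNgt in a0.
have [a1|a1] := leP (-1) a.
  by rewrite ger0_norm; [apply/andP; split; nra|nra].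
by rewrite ler0_norm; [apply/andP; split; nra|nra].
Qed.

Lemma sqr_le_powR (p a : R) : 1 < p -> a ^+ 2 <= 1 + `|a| `^ (p + 1).
Proof.
move=> p1; rewrite -real_normK ?num_real//.
have a0 := normr_ge0 a; have P0 := powR_ge0 `|a| (p + 1).
have [a1|a1] := leP `|a| 1; first by nra.
rewrite -powR_mulrn//.
apply: (@le_trans _ _ (`|a| `^ (p + 1))); last by rewrite lerDr.
by apply: ler_powR; [exact: ltW|rewrite (natrD _ 1 1) lerD2r ltW].
Qed.

End pointwise.

(** * Consequences of the integral constraints *)

Section energy_core.
Context d (T : measurableType d) (R : realType) (mu : {measure set T -> \bar R}).
Variables (D : set T) (w q : T -> R) (p : R).
Hypotheses (mD : measurable D) (D1 : mu D = 1%E) (p1 : 1 < p).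
Hypotheses (mw : measurable_fun D w)
  (wp : mu.-integrable D (fun x => (`|w x| `^ (p + 1))%:E)).

Lemma integrable_cstD (k : R) : mu.-integrable D (fun=> k%:E).
Proof.

apply/integrableP; split; first exact: measurable_cst.
by rewrite integral_cst// D1 mule1 ltry.
Qed.

Lemma integrable_powD (f : T -> R) : measurable_fun D f ->
  (forall x, `|f x| <= 2 + 2 * `|w x| `^ (p + 1)) -> mu.-integrable D (EFin \o f).
Proof.
move=> mf fle.
have := integrableD mD (integrable_cstD 2) (integrableZl mD 2 wp).
apply: le_integrable => //; first exact/measurable_EFinP.
move=> x _; rewrite /= lee_fin; apply: (le_trans (fle x)).
exact: ler_norm.
Qed.

Lemma integrable_sqrD : mu.-integrable D (fun x => (w x ^+ 2)%:E).
Proof.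
apply: integrable_powD; first exact: measurable_funX.
move=> x; rewrite ger0_norm ?sqr_ge0//.
have := sqr_le_powR (w x) p1; have := powR_ge0 `|w x| (p + 1); lra.
Qed.

Lemma integrable_D : mu.-integrable D (EFin \o w).
Proof.
apply: integrable_powD => // x.
have := sqr_le_powR (w x) p1; have := powR_ge0 `|w x| (p + 1).
rewrite -real_normK ?num_real//; nra.
Qed.

Lemma integrable_wellD : mu.-integrable D (fun x => (well (w x))%:E).
Proof.
apply: integrable_powD; first exact: measurableT_comp (@measurable_well R) mw.
move=> x; rewrite ger0_norm ?well_ge0// /well.
have := sqr_le_powR (w x) p1; have P0 := powR_ge0 `|w x| (p + 1).
have N : `|1 - w x ^+ 2| <= 1 + w x ^+ 2.
  by rewrite ler_norml; have := sqr_ge0 (w x); move=> ?; apply/andP; split; lra.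
by case: ifPn => w0; nra.
Qed.

Lemma integrable_energyD : mu.-integrable D (fun x => (w x * `|w x| `^ p)%:E).
Proof.
apply: integrable_powD.
  apply: measurable_funM => //; apply: (measurableT_comp (measurable_powR _)).
  exact: measurableT_comp.
move=> x; rewrite normrM (ger0_norm (powR_ge0 _ _)).
have -> : `|w x| * `|w x| `^ p = `|w x| `^ (p + 1).
  have pp0 : 0 < p + 1 by rewrite addr_gt0// (lt_trans ltr01 p1).
  by have := mulr_powRB1 (normr_ge0 (w x)) pp0; rewrite addrK.
by have := powR_ge0 `|w x| (p + 1); lra.
Qed.

Hypotheses (w0 : (\int[mu]_(x in D) (w x)%:E = 0)%E)
  (w21 : (\int[mu]_(x in D) (w x ^+ 2)%:E = 1)%E)
  (w1 : {ae mu, forall x, D x -> -1 <= w x}).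
Hypotheses (qi : mu.-integrable D (EFin \o q)) (q0 : forall x, 0 <= q x).

(** [L] integrates to 0 by the constraints, so subtracting it preserves the energy and leaves an
    integrand that dominates [well] almost everywhere. The function [q] stands for the gradient
    term. *)
Lemma energy_core :
  (\int[mu]_(x in D) (well (w x) + q x)%:E <=
   \int[mu]_(x in D) (w x * `|w x| `^ p + q x)%:E)%E.
Proof.
pose L x := w x + p / 2 * (w x ^+ 2 - 1).
pose F x := w x * `|w x| `^ p + q x.
have mq : measurable_fun D q by apply/measurable_EFinP; exact: measurable_int qi.
have Fi : mu.-integrable D (EFin \o F) by exact: integrableD integrable_energyD qi.
have i2 := integrableB mD integrable_sqrD (integrable_cstD 1).
have i3 := integrableZl mD (p / 2) i2.
have Li : mu.-integrable D (EFin \o L) by exact: integrableD integrable_D i3.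
have L0 : (\int[mu]_(x in D) (L x)%:E = 0)%E.
  transitivity (\int[mu]_(x in D) ((w x)%:E + (p / 2)%:E * ((w x ^+ 2)%:E - 1%:E)))%E.
    by apply: eq_integral => x _.
  rewrite integralD//; last exact: integrable_D.
  rewrite integralZl// integralB//; [|exact: integrable_sqrD|exact: integrable_cstD].
  by rewrite w0 w21 integral_cst// D1 mule1 subee// mule0 adde0.
have Hi := integrableB mD Fi Li.
have mH : measurable_fun D (fun x => (F x)%:E - (L x)%:E)%E := measurable_int _ Hi.
have HE : (\int[mu]_(x in D) (F x)%:E = \int[mu]_(x in D) ((F x)%:E - (L x)%:E))%E.
  by rewrite integralB// L0 sube0.
have ineq : {ae mu, forall x, D x -> well (w x) + q x <= F x - L x}.
  apply: filterS w1 => x h Dx; have := well_le p1 (h Dx).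
  by rewrite /F /L; lra.
(* The lower bound on [w] holds only almost everywhere; the absolute value gives a majorant that is
   nonnegative at every point, as the comparison of integrals requires. *)
have HE2 : (\int[mu]_(x in D) ((F x)%:E - (L x)%:E) =
    \int[mu]_(x in D) `|(F x)%:E - (L x)%:E|)%E.
  apply: ae_eq_integral => //; first exact: measurableT_comp.
  apply: filterS ineq => x h Dx; rewrite -EFinB abse_EFin ger0_norm//.
  by apply: le_trans (h Dx); rewrite addr_ge0// well_ge0.
rewrite [leRHS](_ : _ = \int[mu]_(x in D) (F x)%:E)%E// HE HE2.
apply: ae_ge0_le_integral => //.
- by move=> x _; rewrite lee_fin addr_ge0// well_ge0.
- apply/measurable_EFinP; apply: measurable_funD => //.
  exact: measurableT_comp (@measurable_well R) mw.
- exact: measurableT_comp.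
- apply: filterS ineq => x h Dx; rewrite -EFinB abse_EFin lee_fin.
  exact: le_trans (h Dx) (ler_norm _).
Qed.

(** With [a] the measure of the positive phase, integrating [well_near_phase] gives
    [|2 a - 1| <= a / 8 + 1 / 4], because [w] has mean 0 and [mu D = 1]. Hence
    [6/17 <= a <= 2/3]. *)
Lemma phase_mass : (\int[mu]_(x in D) (well (w x))%:E <= (1 / 16)%:E)%E ->
  ((1 / 8)%:E < mu (D `&` [set x | (0 < w x)%R]))%E /\
  ((1 / 8)%:E < mu (D `\` [set x | (0 < w x)%R]))%E.
Proof.
move=> W16; set P := D `&` _.
have mP : measurable P.
  rewrite (_ : P = D `&` w @^-1` `]0, +oo[); first exact: mw.
  by apply/seteqP; split=> x []; rewrite /P/= ?in_itv/= ?andbT.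
have mDP : measurable (D `\` P) by exact: measurableD.
have DPE : D `\` [set x | (0 < w x)%R] = D `\` P.
  by apply/seteqP; split=> x [Dx h]; split=> //; [case|move=> wx; apply: h].
have muD : (1 = mu (D `\` P) + mu P)%E.
  by rewrite -D1 (measureDI _ mD mP) setIA setIid.
have Pfin : mu P \is a fin_num.
  by rewrite ge0_fin_numE// (@le_lt_trans _ _ 1%E) ?ltry// muD leeDr.
have DPfin : mu (D `\` P) \is a fin_num.
  by rewrite ge0_fin_numE// (@le_lt_trans _ _ 1%E) ?ltry// muD leeDl.
rewrite DPE; move: muD; rewrite -(fineK Pfin) -(fineK DPfin) -EFinD => -[].
set a := fine (mu P); set b := fine _ => muD; rewrite !lte_fin.
have iW := integrable_wellD.
have Wfin := integrable_fin_num mD iW.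
pose W := (\int[mu]_(x in D) well (w x))%R.
have W16' : W <= 1 / 16 by rewrite -lee_fin /W /Rintegral fineK.
have iP : mu.-integrable D (EFin \o \1_P).
  apply/integrableP; split; first by apply/measurable_EFinP; exact: measurable_indic.
  under eq_integral => x _ do rewrite /= ger0_norm//.
  by rewrite integral_indic// -ge0_fin_numE// /P setIAC setIid -/P.
have IP : (\int[mu]_(x in D) (\1_P x : R) = a)%R.
  by rewrite /Rintegral integral_indic// /P setIAC setIid -/P.
have Iw : (\int[mu]_(x in D) w x = 0)%R by rewrite /Rintegral w0.
have I1 : (\int[mu]_(x in D) (1 : R) = 1)%R by rewrite Rintegral_cst// D1 mulr1.
have i1 := integrable_cstD 1.
have i2P := integrableZl mD 2 iP.
have is_ := integrableB mD i2P i1.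
have ifs := integrableB mD integrable_D is_.
have if8 := integrableZl mD (1 / 8) iP.
have i4 := integrableZl mD 4 iW.
have ig := integrableD mD if8 i4.
have near_phase : `|\int[mu]_(x in D) (w x - (2 * \1_P x - 1))|%R <=
    (\int[mu]_(x in D) (1 / 8 * \1_P x + 4 * well (w x)))%R.
  apply: le_trans (le_normr_Rintegral mD ifs) _.
  apply: le_Rintegral => //; first exact: integrable_norm.
  move=> x Dx; have := well_near_phase (w x); rewrite indicE.
  have -> : (x \in P) = (0 < w x).
    by apply/idP/idP; rewrite inE; [case|].
  have -> : 2 * ((0 < w x)%R : nat)%:R - 1 = if 0 < w x then 1 else - 1 :> R.
    by case: (0 < w x) => /=; ring.
  by lra.
have E1 : (\int[mu]_(x in D) (w x - (2 * \1_P x - 1)) =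
    \int[mu]_(x in D) w x - \int[mu]_(x in D) (2 * \1_P x - 1))%R.
  exact: (RintegralB mD integrable_D is_).
have E2 : (\int[mu]_(x in D) (2 * \1_P x - 1 : R) = 2 * a - 1)%R.
  rewrite -{1}IP -[X in _ = _ - X]I1 -(RintegralZl 2 mD iP).
  exact: (RintegralB mD i2P i1).
have E3 : (\int[mu]_(x in D) (1 / 8 * \1_P x + 4 * well (w x)) = 1 / 8 * a + 4 * W)%R.
  rewrite -{1}IP -(RintegralZl _ mD iP) -(RintegralZl _ mD iW).
  exact: (RintegralD mD if8 i4).
move: near_phase; rewrite E1 E2 E3 Iw ler_norml => /andP[h1 h2].
by split; lra.
Qed.

End energy_core.

(** * Energy estimates for an admissible function *)

Section assembly.
Variables (R : realType) (N : nat) (Omega : set 'rV[R]_N) (p : R).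
Local Notation leb := (@lebesgue_rV R N).
Hypotheses (oO : open Omega) (O1 : leb Omega = 1%E) (p1 : 1 < p).
Implicit Types (v : 'rV[R]_N -> R).

Let mO : measurable Omega. Proof. exact: open_measurable_mx. Qed.

Lemma in_Lp_measurable (r : R) v : in_Lp Omega r v ->
  measurable_fun setT (v \_ Omega).
Proof. by move=> /sub_Lfun_mfun; rewrite inE. Qed.

Lemma in_L2_integrable_sqr v : in_Lp Omega 2 v ->
  leb.-integrable setT (fun x => ((v \_ Omega) x ^+ 2)%:E).
Proof. exact: Lfun2_integrable_sqr. Qed.

Lemma in_L2_integrable v : in_Lp Omega 2 v ->
  leb.-integrable setT (EFin \o v \_ Omega).
Proof.
move=> v2; have mv := in_Lp_measurable v2.
have iO : leb.-integrable setT (fun x => (\1_Omega x)%:E : \bar R).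
  apply/integrableP; split; first by apply/measurable_EFinP; exact: measurable_indic.
  under eq_integral => x _ do rewrite /= ger0_norm//.
  by rewrite integral_indic// setIT [ltLHS]O1 ltry.
apply: (le_integrable measurableT _ _
  (integrableD measurableT iO (in_L2_integrable_sqr v2))).
  exact/measurable_EFinP.
move=> x _; rewrite /= lee_fin indicE patchE; case: ifPn => /= xO; last first.
  by rewrite normr0.
set a := v x; rewrite (@ger0_norm _ (1 + a ^+ 2)) ?addr_ge0 ?sqr_ge0//.
rewrite -(real_normK (num_real a)); have := normr_ge0 a; nra.
Qed.

Lemma weak_gradientP v : sobolev_H1 Omega v ->
  is_L2_weak_gradient Omega v (weak_gradient Omega v).
Proof. by move=> [_ [G vG]]; exact: (xgetPex _ (ex_intro _ G vG)). Qed.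

Section admissible_function.
Variable v : 'rV[R]_N -> R.
Hypothesis vA : admissible Omega p v.
Let w := v \_ Omega.

Let wE x : Omega x -> w x = v x.
Proof. by move=> Ox; rewrite /w patchE mem_set. Qed.

Lemma measurable_admissible : measurable_fun setT w.
Proof. by have [vp _ _ _] := vA; exact: in_Lp_measurable vp. Qed.

Let wp : leb.-integrable Omega (fun x => (`|w x| `^ (p + 1))%:E).
Proof.
have [vp _ _ _] := vA; apply: integrableS (Lfun_integrable _ vp) => //.
by rewrite lerDr (le_trans ler01)// ltW.
Qed.

Let w0 : (\int[leb]_(x in Omega) (w x)%:E = 0)%E.
Proof.
have [_ <- _ _] := vA; apply: eq_integral => x; rewrite inE => Ox.
by rewrite wE.
Qed.

Let w21 : (\int[leb]_(x in Omega) (w x ^+ 2)%:E = 1)%E.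
Proof.
have [_ _ <- _] := vA; apply: eq_integral => x; rewrite inE => Ox.
by rewrite wE.
Qed.

Let w1 : {ae leb, forall x, Omega x -> -1 <= w x}.
Proof. by have [_ _ _] := vA; apply: filterS => x h Ox; rewrite wE//; exact: h. Qed.

Let mw : measurable_fun Omega w.
Proof. by apply: measurable_funTS; exact: measurable_admissible. Qed.

Lemma well_le_energy q :
  leb.-integrable Omega (EFin \o q) -> (forall x, 0 <= q x) ->
  (\int[leb]_(x in Omega) (well (w x))%:E + \int[leb]_(x in Omega) (q x)%:E <=
   \int[leb]_(x in Omega) (v x * `|v x| `^ p + q x)%:E)%E.
Proof.
move=> qi q0.
have mq : measurable_fun Omega (EFin \o q) := measurable_int _ qi.
have -> : (\int[leb]_(x in Omega) (v x * `|v x| `^ p + q x)%:E =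
    \int[leb]_(x in Omega) (w x * `|w x| `^ p + q x)%:E)%E.
  by apply: eq_integral => x; rewrite inE => Ox; rewrite wE.
rewrite -ge0_integralD//; last 3 first.
- by move=> x _; rewrite lee_fin well_ge0.
- by apply/measurable_EFinP; exact: measurableT_comp (@measurable_well R) mw.
- by move=> x _; rewrite lee_fin.
exact: (energy_core mO O1 p1 mw wp w0 w21 w1 qi q0).
Qed.

Lemma phase_mass_admissible :
  (\int[leb]_(x in Omega) (well (w x))%:E <= (1 / 16)%:E)%E ->
  ((1 / 8)%:E < leb (Omega `&` [set x | (0 < w x)%R]))%E /\
  ((1 / 8)%:E < leb (Omega `\` [set x | (0 < w x)%R]))%E.
Proof. exact: (phase_mass mO O1 p1 mw wp w0). Qed.

Lemma energy0_ge0 : (0 <= energy Omega p 0 v)%E.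
Proof.
rewrite /energy eqxx.
have := @well_le_energy (cst 0) (integrable0 _ _) (fun=> lexx 0).
under [X in (_ <= X)%E -> _]eq_integral do rewrite addr0.
apply: le_trans; apply: adde_ge0; apply: integral_ge0 => x _ //.
by rewrite lee_fin well_ge0.
Qed.

Lemma energy_lower (theta : R) (i : 'I_N) : 0 < theta -> sobolev_H1 Omega v ->
  (\int[leb]_(x in Omega) (well (w x))%:E +
   theta%:E * \int[leb]_x
     (((fun x => weak_gradient Omega v x ord0 i) \_ Omega) x ^+ 2)%:E
   <= energy Omega p theta v)%E.
Proof.
move=> theta0 vH; rewrite /energy gt_eqF//; case: pselect => [h|//] /=.
have vG := weak_gradientP vH.
set G := weak_gradient Omega v in vG *.
have Gi j : leb.-integrable Omega (fun x => (G x ord0 j ^+ 2)%:E).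
  have [G2 _] := vG j.
  apply: eq_integrable (integrableS measurableT mO _ (in_L2_integrable_sqr G2)) => //.
  by move=> x; rewrite inE => Ox; rewrite patchE mem_set.
have sE x : ((theta * sqr_euclid (G x))%:E =
    theta%:E * \sum_(j < N) (G x ord0 j ^+ 2)%:E)%E.
  by rewrite EFinM /sqr_euclid sumEFin.
have qi : leb.-integrable Omega (fun x => (theta * sqr_euclid (G x))%:E).
  under eq_fun do rewrite sE.
  by apply: integrableZl => //; apply: integrable_sum => // j _; exact: Gi.
have sq0 x : 0 <= sqr_euclid (G x) by apply: sumr_ge0 => j _; exact: sqr_ge0.
apply: le_trans (well_le_energy qi _); last by move=> x; rewrite mulr_ge0// ltW.
apply: leeD2l; rewrite -ge0_integralZl//; last 3 first.
- have [G2 _] := vG i; exact: measurable_int (in_L2_integrable_sqr G2).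
- by move=> x _; rewrite lee_fin sqr_ge0.
- by rewrite lee_fin ltW.
rewrite [leRHS]integral_mkcond; apply: ge0_le_integral => //.
- by move=> x _; rewrite mule_ge0 ?lee_fin ?sqr_ge0// ltW.
- apply: measurable_funeM.
  have [G2 _] := vG i; exact: measurable_int (in_L2_integrable_sqr G2).
- by apply/(measurable_restrictT _ mO); exact: measurable_int qi.
move=> x _; rewrite !patchE; case: ifPn => _; last by rewrite expr0n mule0.
rewrite -EFinM lee_fin ler_wpM2l ?(ltW theta0)// /sqr_euclid (bigD1 i)//= lerDl.
by apply: sumr_ge0 => j _; exact: sqr_ge0.
Qed.

Lemma well_le_energy_H1 (theta : R) (i : 'I_N) : 0 < theta -> sobolev_H1 Omega v ->
  (\int[leb]_(x in Omega) (well (w x))%:E <= energy Omega p theta v)%E.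
Proof.
move=> t0 vH; apply: le_trans (energy_lower i t0 vH).
rewrite leeDl// mule_ge0 ?lee_fin ?(ltW t0)//.
by apply: integral_ge0 => x _; rewrite lee_fin sqr_ge0.
Qed.

Lemma positivity_jumps (theta E : R) (c : 'rV[R]_N) (r : R) :
  0 < theta -> sobolev_H1 Omega v -> energy Omega p theta v = E%:E ->
  good Omega c r -> forall (i : 'I_N) (t : R), 0 < t <= Num.sqrt theta ->
  (leb (jumps (fun x => 0 < w x)%R c r (t *: delta_mx ord0 i)) <= (16 * E)%:E)%E.
Proof.
move=> theta0 vH EE [r0 cr] i t /andP[t0 tle].
have vG := weak_gradientP vH.
have := energy_lower i theta0 vH; rewrite EE.
set g := (_ \_ Omega); set e := delta_mx ord0 i.
have [G2 _] := vG i.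
have gi : leb.-integrable setT (EFin \o g) by exact: in_L2_integrable.
have wi : leb.-integrable setT (EFin \o w) by apply: in_L2_integrable; case: vH.
(* Shortening the box by [t] along the i-th axis makes its swept box exactly the closed cube. *)
pose a j := c ord0 j - r; pose b j := c ord0 j + r - (if j == i then t else 0).
have abO : swept_box i t a b `<=` Omega.
  move=> x xab; apply: cr; split=> [|k j]; first by rewrite mulr_gt0.
  rewrite (ord1 k) /ball/= distrC ltr_distl; have := xab j.
  by rewrite /a /b subrK => /andP[? ?]; apply/andP; split; lra.
have wd := weak_difference vG wi gi (ltW t0) abO.
set D := ball c r `&` [set x | ball c r (x + t *: e)].
have mQ : measurable (ball c r) by apply: open_measurable_mx; exact: ball_open.
have mD : measurable D.
  apply: measurableI => //; have := measurable_shift (t *: e) measurableT mQ.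
  by rewrite setTI.
have QO : ball c r `<=` Omega by apply: subset_trans cr; apply: le_ball; lra.
have DO : D `<=` Omega by move=> x [/QO].
have DtO z : D z -> Omega (z + t *: e) by move=> [_ /QO].
have w_slide : {ae leb, forall z, D z -> w (z + t *: e) - w z = slide g e t z}.
  apply: filterS wd => z h [[_ zc] [_ zt]]; apply: h => j.
  move: (zc ord0 j) (zt ord0 j); rewrite /ball/= coord_line !ltr_norml /a /b.
  by case: ifP => _ /andP[? ?] /andP[? ?]; apply/andP; split; lra.
have := jump_measure mO mD t0 measurable_admissible gi DO DtO w_slide.
rewrite /jumps -/D => J EL; apply: (le_trans J).
have c16 : (0 <= 16%:E :> \bar R)%E by rewrite lee_fin.
rewrite EFinM; apply: le_trans (lee_wpmul2l c16 EL).
have g20 : (0 <= \int[leb]_x (g x ^+ 2)%:E)%E.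
  by apply: integral_ge0 => x _; rewrite lee_fin sqr_ge0.
have W0 : (0 <= \int[leb]_(x in Omega) (well (w x))%:E)%E.
  by apply: integral_ge0 => x _; rewrite lee_fin well_ge0.
move: W0 g20; move: (\int[leb]_(x in Omega) _)%E (\int[leb]_x _)%E => X Y X0 Y0.
rewrite ge0_muleDr ?mule_ge0 ?lee_fin ?(ltW theta0)//.
apply: leeD2l.
rewrite muleA -EFinM lee_wpmul2r// lee_fin.
(* This is where the step is limited to [sqrt theta]: the gradient term [4 t^2] is then absorbed in
   [16 theta]. *)
have : t ^+ 2 <= theta.
  by rewrite -(sqr_sqrtr (ltW theta0)) lerXn2r ?nnegrE ?sqrtr_ge0// ltW.
lra.
Qed.

End admissible_function.
End assembly.

(** [mass_product_le] and [jumps_le] with [tau = sqrt theta] and [B = 16 E]. Since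
    [sqrt theta <= 1], the step count [2 r / sqrt theta + 1] is at most [(2 r + 1) / sqrt theta], so
    only the ratio [E / sqrt theta] remains. *)
Lemma good_phases (R : realType) (N : nat) (Omega : set 'rV[R]_N) (p : R)
    (v : 'rV[R]_N -> R) (theta E : R) (c : 'rV[R]_N) (r : R) :
  open Omega -> lebesgue_rV Omega = 1%E -> 1 < p -> admissible Omega p v ->
  sobolev_H1 Omega v -> 0 < theta <= 1 -> 0 <= E -> energy Omega p theta v = E%:E ->
  good Omega c r ->
  (lebesgue_rV (ball c r `&` [set x | (0 < (v \_ Omega) x)%R]) *
   lebesgue_rV (ball c r `\` [set x | (0 < (v \_ Omega) x)%R]) <=
   (N%:R * ((2 * r + 1) * 16) * (E / Num.sqrt theta))%:E)%E.
Proof.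
move=> oO O1 p1 vA vH /andP[theta0 theta1] E0 EE g; have [r0 cr] := g.
have s0 : 0 < Num.sqrt theta by rewrite sqrtr_gt0.
have s1 : Num.sqrt theta <= 1 by rewrite -sqrtr1 ler_sqrt.
have mA : measurable [set x | 0 < (v \_ Omega) x].
  rewrite (_ : [set _ | _] = (v \_ Omega) @^-1` `]0, +oo[).
    by rewrite -[X in measurable X]setTI; exact: measurable_admissible vA _ _ _.
  by apply/seteqP; split=> x; rewrite /= in_itv/= andbT.
have small := positivity_jumps oO O1 p1 vA theta0 vH EE g.
have E160 : 0 <= 16 * E by rewrite mulr_ge0.
pose M := N%:R * ((2 * r + 1) * 16) * (E / Num.sqrt theta).
have ball1 : (lebesgue_rV (ball (0%R : 'rV[R]_N) (2 * r)%R) <= 1)%E.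
  rewrite -O1 (_ : ball 0 _ = (fun x => x + c) @^-1` ball c (2 * r)).
    rewrite lebesgue_rV_shift; last by apply: open_measurable_mx; exact: ball_open.
    apply: le_measure => //; rewrite ?inE.
    - by apply: open_measurable_mx; exact: ball_open.
    - exact: open_measurable_mx.
  have E1 (a b : R) : a - (b + a) = 0 - b by ring.
  apply/seteqP; split=> x [h0 h]; split=> // i j.
    by have := h i j; rewrite /ball/= !mxE E1.
  by have := h i j; rewrite /ball/= !mxE E1.
have M0 : 0 <= M.
  apply: mulr_ge0; last by rewrite divr_ge0// sqrtr_ge0.
  by apply: mulr_ge0 => //; rewrite mulr_ge0// addr_ge0// mulr_ge0// ltW.
apply: (@le_trans _ _ (M%:E * lebesgue_rV (ball (0%R : 'rV[R]_N) (2 * r)%R))%E); last first.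
  by rewrite -[leRHS]mule1 lee_wpmul2l ?lee_fin.
apply: mass_product_le => // h hr.
apply: (le_trans (jumps_le mA r0 s0 E160 small hr)).
rewrite lee_fin (_ : M = N%:R * ((2 * r + 1) / Num.sqrt theta * (16 * E))); last first.
  by rewrite /M; ring.
rewrite ler_wpM2l//.
rewrite ler_wpM2r//.
rewrite [leRHS]mulrDl lerD2l div1r.
by rewrite invf_ge1.
Qed.

Theorem theorem1p4 (R : realType) (N : nat) (Omega : set 'rV[R]_N) (p : R) :
  (0 < N)%N ->
  open Omega -> connected Omega -> bounded_set Omega -> C2_boundary Omega ->
  lebesgue_rV Omega = 1%E ->
  1 < p ->
  exists theta0 C : R, [/\ 0 < theta0, 0 < C &
    forall theta : R, 0 <= theta <= theta0 ->
      ((C * Num.sqrt theta)%:E <=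
       ereal_inf [set energy Omega p theta v | v in admissible Omega p])%E].
Proof.
move=> N0 oO cO _ _ O1 p1.
(* All pairs [(theta, v)] of finite energy are treated as one family, so that [eps] below depends on
   none of them. *)
pose I := {tv : R * ('rV[R]_N -> R) | [/\ 0 < tv.1 <= 1, admissible Omega p tv.2,
  sobolev_H1 Omega tv.2 & (0 <= energy Omega p tv.1 tv.2 < +oo)%E]}.
pose A (i : I) := [set x | 0 < ((sval i).2 \_ Omega) x].
pose delta (i : I) := fine (energy Omega p (sval i).1 (sval i).2) / Num.sqrt (sval i).1.
have mA i : measurable (A i).
  rewrite (_ : A i = ((sval i).2 \_ Omega) @^-1` `]0, +oo[).
    rewrite -[X in measurable X]setTI.
    have [_ vA _ _] := svalP i; exact: measurable_admissible vA _ _ _.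
  by apply/seteqP; split=> x; rewrite /A/= in_itv/= andbT.
have phases c r : good Omega c r -> settled A delta (ball c r).
  move=> g eta eta0; have [r0 _] := g.
  pose K := N%:R * ((2 * r + 1) * 16).
  have K0 : 0 <= K by rewrite mulr_ge0// mulr_ge0// addr_ge0// mulr_ge0// ltW.
  have K10 : 0 < K + 1 by rewrite ltr_wpDl.
  (* If both phases exceeded [eta] in the cube, the product of their measures would exceed [eta^2],
     while it is at most [K * delta i]. Dividing by [K + 1] avoids a separate case [K = 0]. *)
  exists (eta ^+ 2 / (K + 1)); first by rewrite divr_gt0// exprn_gt0.
  move=> i; rewrite ler_pdivlMr// => di.
  have [t01 vA vH /andP[E0 Eoo]] := svalP i.
  have Efin : energy Omega p (sval i).1 (sval i).2 \is a fin_num.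
    by rewrite ge0_fin_numE.
  have := good_phases oO O1 p1 vA vH t01 (fine_ge0 E0) (esym (fineK Efin)) g.
  rewrite -/(A i) -/(delta i) -/K => prodle.
  have d0 : 0 <= delta i by rewrite divr_ge0 ?fine_ge0 ?sqrtr_ge0.
  apply: contrapT => /forallNP Nb.
  have := Nb true; have := Nb false; rewrite /side => /negP + /negP.
  rewrite -!ltNge => hF hT.
  have : ((eta * eta)%:E < (K * delta i)%:E)%E.
    apply: lt_le_trans prodle; rewrite EFinM.
    by apply: lte_pmul => //; rewrite lee_fin ltW.
  rewrite lte_fin -expr2; nra.
have eta0 : 0 < 1 / 8 :> R by rewrite divr_gt0.
have [eps eps0 main] := connected_dichotomy oO cO O1 mA phases eta0.
(* [eps] triggers the dichotomy with [eta = 1/8]. Since [sqrt theta <= 1], the bound 1/16 makes the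
   well energy small enough for [phase_mass], whose strict lower bounds 1/8 contradict that
   dichotomy. *)
pose C := Num.min eps (1 / 16).
have C0 : 0 < C by rewrite lt_min eps0 divr_gt0.
exists 1, C; split => // theta /andP[theta0 theta1].
apply: le_ereal_inf_tmp => _ [v vA <-].
have [->|tn0] := eqVneq theta 0.
  by rewrite sqrtr0 mulr0; exact: energy0_ge0 vA.
have tgt0 : 0 < theta by rewrite lt_neqAle eq_sym tn0.
have s0 : 0 < Num.sqrt theta by rewrite sqrtr_gt0.
have s1 : Num.sqrt theta <= 1 by rewrite -sqrtr1 ler_sqrt.
have [vH|vNH] := pselect (sobolev_H1 Omega v); last first.
  by rewrite /energy (negbTE tn0); case: pselect => // ? /=; rewrite leey.
have WE := well_le_energy_H1 oO O1 p1 vA (Ordinal N0) tgt0 vH.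
have W0 : (0 <= \int[lebesgue_rV]_(x in Omega) (well ((v \_ Omega) x))%:E)%E.
  by apply: integral_ge0 => x _; rewrite lee_fin well_ge0.
have E0 := le_trans W0 WE.
rewrite leNgt; apply/negP => Elt.
have Eoo : (energy Omega p theta v < +oo)%E by apply: lt_trans Elt _; rewrite ltry.
have Efin : energy Omega p theta v \is a fin_num by rewrite ge0_fin_numE.
have Iv : [/\ 0 < (theta, v).1 <= 1, admissible Omega p (theta, v).2,
    sobolev_H1 Omega (theta, v).2 &
    (0 <= energy Omega p (theta, v).1 (theta, v).2 < +oo)%E].
  by split => //=; [apply/andP|apply/andP].
pose i : I := exist _ (theta, v) Iv.
move: (Elt); rewrite -{1}(fineK Efin) lte_fin => Elt'.
have [] := main i _.
  rewrite /delta /= ler_pdivrMr//; apply: (le_trans (ltW Elt')).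
  by rewrite ler_pM2r// ge_min lexx.
have W16 : (\int[lebesgue_rV]_(x in Omega) (well ((v \_ Omega) x))%:E <=
    (1 / 16)%:E)%E.
  apply: (le_trans WE); apply: (le_trans (ltW Elt)); rewrite lee_fin.
  rewrite -[leRHS]mulr1 ler_pM ?(ltW C0) ?(ltW s0)//.
  by rewrite ge_min lexx orbT.
have [hT hF] := phase_mass_admissible oO O1 p1 vA W16.
by case; rewrite /side /A /= leNgt; apply/negP; rewrite negbK;
  [exact: hT|exact: hF].
Qed.
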